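(* On $\mathfrak{J}^{\mathbb{C}}\setminus\{0\}$ equipped with the symplectic form $\sqrt{2}\,\sqrt{-1}\,\overline{\partial}\partial\|A\|^{\frac12}$, the flow $\phi_t(A)=e^{-2\sqrt{-1}\,t}A$ ($t\in\mathbb{R}$) is a Hamiltonian flow with Hamiltonian $f(A)=\frac{1}{\sqrt2}\|A\|^{\frac12}$. The flow leaves $\mathbb{E}=\{A\in\mathfrak{J}^{\mathbb{C}} : A\circ A=0,\ A\neq0\}$ invariant, and on $\mathbb{E}$ (with the restricted symplectic form) it is the Hamiltonian flow of $f|_{\mathbb{E}}$. Under the identification $\tau_{\mathcal{O}}:T_0^*P^2\mathcal{O}\to\mathbb{E}$, the function $f|_{\mathbb{E}}$ is the square root of the metric function, $f(\tau_{\mathcal{O}}(X,Y))=\|Y\|_{\mathbb{P}}$, so that $\{\phi_t\}$ is the bicharacteristic flow of the square root of the Laplacian on $P^2\mathcal{O}$ (the Hamiltonian flow of $(X,Y)\mapsto\|Y\|_{\mathbb{P}}$ on $(T_0^*P^2\mathcal{O},\omega_{\mathcal{O}})$). In particular, restricted to the unit sphere bundle $\{(X,Y)\in TP^2\mathcal{O} : \|Y\|_{\mathbb{P}}=1\}$, it coincides with the geodesic flow of $P^2\mathcal{O}$.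
   Context: Octonions: $\mathbb{H}$ is the quaternion algebra over $\mathbb{R}$ with basis $e_0=1,e_1,e_2,e_3$ ($e_i^2=-1$, $e_1e_2=-e_2e_1=e_3$ and cyclic permutations), $\theta$ is quaternion conjugation. The Cayley algebra is $\mathcal{O}=\mathbb{H}\oplus\mathbb{H}e_4$ with product $(a+be_4)(h+ke_4)=ah-\theta(k)b+\{ka+b\theta(h)\}e_4$; $e_5=e_1e_4$, $e_6=e_2e_4$, $e_7=e_3e_4$. The basis $e_0,\dots,e_7$ is orthonormal for the inner product $\langle\cdot,\cdot\rangle$ on $\mathcal{O}$, and $\theta(\sum_{i=0}^7h_ie_i)=h_0e_0-\sum_{i=1}^7h_ie_i$. Jordan algebra: $\mathfrak{J}=\{X\in M(3,\mathcal{O}) : \theta({}^tX)=X\}$ (with $\theta$ applied entrywise), a real vector space of dimension 27, with Jordan product $X\circ Y=\frac12(XY+YX)$. $\operatorname{tr}X$ is the sum of the diagonal entries. The inner product is $(X,Y)=\operatorname{tr}(X\circ Y)$; for $$X=\begin{pmatrix}\xi_1&x_3&\theta(x_2)\\ \theta(x_3)&\xi_2&x_1\\ x_2&\theta(x_1)&\xi_3\end{pmatrix},\quad Y=\begin{pmatrix}\eta_1&y_3&\theta(y_2)\\ \theta(y_3)&\eta_2&y_1\\ y_2&\theta(y_1)&\eta_3\end{pmatrix}$$ ($\xi_i,\eta_i\in\mathbb{R}$, $x_i,y_i\in\mathcal{O}$) it equals $\sum_{i=1}^3(\xi_i\eta_i+2\langle x_i,y_i\rangle)$. Norm: $\|Y\|^2=(Y,Y)$.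 Complexification: $\mathfrak{J}^{\mathbb{C}}=\mathfrak{J}\otimes_{\mathbb{R}}\mathbb{C}$, with $\circ$, $\operatorname{tr}$, $(\cdot,\cdot)$ extended complex (bi)linearly; $\overline{A}$ is complex conjugation in the factor $\mathbb{C}$; $\|A\|^2=(A,\overline{A})$. $\partial,\overline{\partial}$ are the Dolbeault operators of the complex vector space $\mathfrak{J}^{\mathbb{C}}$. Cayley projective plane: $P^2\mathcal{O}=\{X\in\mathfrak{J} : X\circ X=X,\ \operatorname{tr}X=1\}$, and $TP^2\mathcal{O}=\{(X,Y)\in\mathfrak{J}\times\mathfrak{J} : X\circ X=X,\ \operatorname{tr}X=1,\ X\circ Y=\frac12Y\}$. The Riemannian metric is $(Y_1,Y_2)_{\mathbb{P}}=\frac12(Y_1,Y_2)$ with norm $\|\cdot\|_{\mathbb{P}}$; the cotangent bundle is identified with the tangent bundle through this metric, and $T_0^*P^2\mathcal{O}$ is the cotangent bundle with the zero section removed. Under this identification the natural symplectic form is $\omega_{\mathcal{O}}=-\frac12(dX,dY)$, meaning the restriction to $TP^2\mathcal{O}\subset\mathfrak{J}\times\mathfrak{J}$ of $\frac12\bigl(\sum_{i=1}^3d\eta_i\wedge d\xi_i+2\sum_{i=1}^3\sum_{\alpha=0}^7dy^i_\alpha\wedge dx^i_\alpha\bigr)$, where $\xi_i,x_i=\sum_\alpha x^i_\alpha e_\alpha$ are the coordinates of $X$ and $\eta_i,y_i=\sum_\alpha y^i_\alpha e_\alpha$ those of $Y$. With the sign convention ''$d(\text{momentum})\wedge d(\text{position})$''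 used here, the Hamiltonian vector field $v$ of a function $H$ on a symplectic manifold $(M,\omega)$ is given by $\iota_v\omega=-dH$. The map $\tau_{\mathcal{O}}$ is $\tau_{\mathcal{O}}(X,Y)=(\|Y\|^2X-Y\circ Y)\otimes1+\frac{1}{\sqrt2}\|Y\|\,Y\otimes\sqrt{-1}$; it is a diffeomorphism of $T_0^*P^2\mathcal{O}$ onto the complex submanifold $\mathbb{E}$ of $\mathfrak{J}^{\mathbb{C}}\setminus\{0\}$, and $\tau_{\mathcal{O}}^*(\sqrt2\,\sqrt{-1}\,\overline{\partial}\partial\|A\|^{1/2})=\omega_{\mathcal{O}}$. *)

(* Defs.v *)
From HB Require Import structures.
From mathcomp Require Import all_boot all_order all_algebra.
From mathcomp Require Import all_classical all_reals all_analysis.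
From mathcomp Require Import complex ring lra.
Set Implicit Arguments.
Unset Strict Implicit.
Unset Printing Implicit Defensive.
Import Order.TTheory GRing.Theory Num.Theory.
Import numFieldNormedType.Exports.
Local Open Scope classical_set_scope.
Local Open Scope ring_scope.
Local Open Scope complex_scope.

Section Octonions.
Context {R : realType}.

Definition qmul (a b : 'rV[R]_4) : 'rV[R]_4 :=
  \row_(k < 4) nth 0
    [:: a 0 0 * b 0 0 - a 0 1 * b 0 1 - a 0 2 * b 0 2 - a 0 3 * b 0 3;
        a 0 0 * b 0 1 + a 0 1 * b 0 0 + a 0 2 * b 0 3 - a 0 3 * b 0 2;
        a 0 0 * b 0 2 - a 0 1 * b 0 3 + a 0 2 * b 0 0 + a 0 3 * b 0 1;
        a 0 0 * b 0 3 + a 0 1 * b 0 2 - a 0 2 * b 0 1 + a 0 3 * b 0 0] k.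

Definition qconj (a : 'rV[R]_4) : 'rV[R]_4 :=
  \row_(k < 4) (if k == 0 then a 0 k else - a 0 k).

(* An octonion is the row of its coordinates in e_0, ..., e_7.  Since
   e_(4+k) = e_k e_4, the left and right halves of the row are the quaternions
   a and b in the decomposition a + b e_4. *)
Definition omul (x y : 'rV[R]_8) : 'rV[R]_8 :=
  let a := lsubmx (x : 'rV_(4 + 4)) in let b := rsubmx (x : 'rV_(4 + 4)) in
  let h := lsubmx (y : 'rV_(4 + 4)) in let k := rsubmx (y : 'rV_(4 + 4)) in
  row_mx (qmul a h - qmul (qconj k) b) (qmul k a + qmul b (qconj h)).

Definition oconj (x : 'rV[R]_8) : 'rV[R]_8 :=
  \row_(k < 8) (if k == 0 then x 0 k else - x 0 k).

Definition odot (x y : 'rV[R]_8) : R := \sum_(k < 8) x 0 k * y 0 k.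

Definition oreal (r : R) : 'rV[R]_8 := r *: delta_mx 0 0.

(* Octonions do not form a ring in the sense of the library, hence neither do
   their matrices. *)
Definition omulmx (X Y : 'M['rV[R]_8]_3) : 'M['rV[R]_8]_3 :=
  \matrix_(i, j) \sum_(k < 3) omul (X i k) (Y k j).

Definition omx_herm (X : 'M['rV[R]_8]_3) : Prop := map_mx oconj X^T = X.

Definition omx_jordan (X Y : 'M['rV[R]_8]_3) : 'M['rV[R]_8]_3 :=
  map_mx ( *:%R 2^-1) (omulmx X Y + omulmx Y X).

End Octonions.

(* The Jordan algebra, in coordinates: (xi, x) : jordan R stands for the
   Hermitian matrix jmx (xi, x) below, with xi the row (xi_1, xi_2, xi_3) and
   x the matrix whose rows are x_1, x_2, x_3 (all indices shifted to start at
   0).  This makes it a normed module over R, on which the library's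
   differential calculus is available.  Lemmas jmxK, omx_to_jK, jmx_herm and
   jmx_jmul show that jmx is an isomorphism onto the Hermitian matrices with
   their Jordan product, and jdotE computes the inner product in coordinates. *)
Notation jordan R := ('rV[R]_3 * 'M[R]_(3, 8))%type.

Section Jordan.
Context {R : realType}.
Implicit Types X Y : jordan R.

Definition jmx X : 'M['rV[R]_8]_3 :=
  let xi i := oreal (X.1 0 i) in let x i := row i X.2 in
  \matrix_(i < 3, j < 3) nth 0 (nth [::]
    [:: [:: xi 0;        x 2;          oconj (x 1)];
        [:: oconj (x 2); xi 1;         x 0        ];
        [:: x 1;         oconj (x 0);  xi 2       ]] i) j.

(* x_1, x_2, x_3 are the (2,3), (3,1) and (1,2) entries; the indices in 'I_3
   are added modulo 3. *)
Definition omx_to_j (M : 'M['rV[R]_8]_3) : jordan R :=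
  (\row_(i < 3) M i i 0 0, \matrix_(i < 3, k < 8) M (i + 1) (i + 2) 0 k).

Definition jmul X Y : jordan R := omx_to_j (omx_jordan (jmx X) (jmx Y)).

Definition jtr X : R := \sum_(i < 3) X.1 0 i.

Definition jdot X Y : R := jtr (jmul X Y).

Definition jnorm X : R := Num.sqrt (jdot X X).

End Jordan.

(* (A, B) : jordanC R stands for A (x) 1 + B (x) sqrt(-1). *)
Notation jordanC R := (jordan R * jordan R)%type.

Section JordanC.
Context {R : realType}.
Implicit Types A B : jordanC R.

Definition cscale (z : R[i]) A : jordanC R :=
  (complex.Re z *: A.1 - complex.Im z *: A.2,
   complex.Re z *: A.2 + complex.Im z *: A.1).

Definition jconjC A : jordanC R := (A.1, - A.2).

Definition jmulC A B : jordanC R :=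
  (jmul A.1 B.1 - jmul A.2 B.2, jmul A.1 B.2 + jmul A.2 B.1).

Definition jdotC A B : R[i] :=
  (jdot A.1 B.1 - jdot A.2 B.2) +i* (jdot A.1 B.2 + jdot A.2 B.1).

Definition jnormC A : R := Num.sqrt (complex.Re (jdotC A (jconjC A))).

End JordanC.

Section Dolbeault.
Context {R : realType}.

(* Complex-valued differential forms on jordanC R, regarded as a real vector
   space; (a /\ b)(u, v) = a(u) b(v) - a(v) b(u). *)
Definition form0 := jordanC R -> R[i].
Definition form1 := jordanC R -> jordanC R -> R[i].
Definition form2 := jordanC R -> jordanC R -> jordanC R -> R[i].

Definition ext_d0 (F : form0) : form1 := fun x u =>
  'D_u (fun y => complex.Re (F y)) x +i* 'D_u (fun y => complex.Im (F y)) x.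

Definition ext_d1 (a : form1) : form2 := fun x u v =>
  ext_d0 (fun y => a y v) x u - ext_d0 (fun y => a y u) x v.

Definition ext_d2 (b : form2) x u v w : R[i] :=
  ext_d0 (fun y => b y v w) x u - ext_d0 (fun y => b y u w) x v
  + ext_d0 (fun y => b y u v) x w.

Definition part10 (a : form1) : form1 := fun x u =>
  (a x u - 'i * a x (cscale 'i u)) / 2.

Definition part11 (b : form2) : form2 := fun x u v =>
  (b x u v + b x (cscale 'i u) (cscale 'i v)) / 2.

Definition del (F : form0) : form1 := part10 (ext_d0 F).

(* The operator bar-partial on forms of type (1,0). *)
Definition delbar10 (a : form1) : form2 := part11 (ext_d1 a).

Definition symplectic_form (U : set (jordanC R)) (om : form2) : Prop :=
  forall x, U x ->
  [/\ forall u v, complex.Im (om x u v) = 0,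
      (forall u, om x u u = 0) /\
      (forall (a : R) u u' v, om x (a *: u + u') v
                              = a%:C * om x u v + om x u' v),
      forall u v, differentiable (fun y => complex.Re (om y u v)) x,
      forall u v w, ext_d2 om x u v w = 0 &
      forall u, (forall v, om x u v = 0) -> u = 0].

End Dolbeault.

Section Hamiltonian.
Context {R : realType} {V : normedModType R}.

(* Tangent vectors of a submanifold M of V, as velocities of curves in M. *)
Definition tangent (M : set V) (x v : V) : Prop :=
  exists g : R -> V, [/\ g 0 = x, \forall t \near 0, M (g t) &
                         is_derive (0 : R) 1 g v].

(* i_v om = - dH on M, for om and H the restrictions to M of a form and of a
   function given on (an open subset of) V. *)
Definition hamiltonian_vf (M : set V) (om : V -> V -> V -> R[i]) (H : V -> R)
    (v : V -> V) : Prop :=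
  forall x, M x ->
  [/\ tangent M x (v x), differentiable H x &
      forall w, tangent M x w -> om x (v x) w = (- 'd H x w)%:C].

Definition hamiltonian_flow (M : set V) (om : V -> V -> V -> R[i]) (H : V -> R)
    (phi : R -> V -> V) : Prop :=
  exists2 v, hamiltonian_vf M om H v &
  forall x, M x ->
  [/\ phi 0 x = x,
      forall t, M (phi t x),
      forall s t, phi (s + t) x = phi s (phi t x) &
      forall t : R, is_derive t 1 (fun s => phi s x) (v (phi t x))].

End Hamiltonian.

Section CayleyPlane.
Context {R : realType}.

Definition cayley_plane : set (jordan R) :=
  [set X | jmul X X = X /\ jtr X = 1].

Definition cayley_tangent : set (jordan R * jordan R) :=
  [set p | [/\ jmul p.1 p.1 = p.1, jtr p.1 = 1 &
               jmul p.1 p.2 = 2^-1 *: p.2]].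

Definition metricP (Y1 Y2 : jordan R) : R := jdot Y1 Y2 / 2.

Definition normP (Y : jordan R) : R := Num.sqrt (metricP Y Y).

Definition cayley_cotangent0 : set (jordan R * jordan R) :=
  [set p | cayley_tangent p /\ p.2 != 0].

Definition cayley_sphere : set (jordan R * jordan R) :=
  [set p | cayley_tangent p /\ normP p.2 = 1].

(* In (X, Y) : jordan R * jordan R, the coordinates of X = p.1 are xi and x,
   those of Y = p.2 are eta and y. *)
Definition omegaO (p u v : jordan R * jordan R) : R[i] :=
  let wedge (a b : jordan R * jordan R -> R) := a u * b v - a v * b u in
  (2^-1 * (\sum_(i < 3) wedge (fun w => w.2.1 0 i) (fun w => w.1.1 0 i)
    + 2 * \sum_(i < 3) \sum_(k < 8)
            wedge (fun w => w.2.2 i k) (fun w => w.1.2 i k)))%:C.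

Definition tauO (p : jordan R * jordan R) : jordanC R :=
  (jnorm p.2 ^+ 2 *: p.1 - jmul p.2 p.2,
   (jnorm p.2 / Num.sqrt 2) *: p.2).

(* The metric is the restriction of half the inner product of the ambient
   space, so the Levi-Civita covariant derivative along a curve is the
   tangential component of the ordinary derivative; a geodesic is a curve whose
   velocity has zero covariant derivative. *)
Definition geodesic (g : R -> jordan R) : Prop :=
  forall t : R,
  [/\ cayley_plane (g t), derivable g t 1, derivable (derive1 g) t 1 &
      forall w, cayley_tangent (g t, w) ->
        metricP (derive1 (derive1 g) t) w = 0].

Definition geodesic_flow (S : set (jordan R * jordan R))
    (psi : R -> jordan R * jordan R -> jordan R * jordan R) : Prop :=
  forall p, S p ->
  exists2 g, geodesic g &
    (g 0, derive1 g 0) = p /\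
    forall t, S (psi t p) /\ psi t p = (g t, derive1 g t).

End CayleyPlane.

Section TheFlow.
Context {R : realType}.

Definition jordanC0 : set (jordanC R) := [set A | A != 0].

Definition omegaC : @form2 R := fun A u v =>
  (Num.sqrt 2)%:C * 'i *
  delbar10 (del (fun A => (Num.sqrt (jnormC A))%:C)) A u v.

Definition phiC (t : R) (A : jordanC R) : jordanC R :=
  cscale (cos (- 2 * t) +i* sin (- 2 * t)) A.

Definition fC (A : jordanC R) : R := Num.sqrt (jnormC A) / Num.sqrt 2.

Definition nullcone : set (jordanC R) :=
  [set A | jmulC A A = 0 /\ A != 0].

(* pinv picks preimages in cayley_cotangent0, so once tauO is known to be
   bijective onto nullcone this is the flow phiC transported by tauO. *)
Definition psiO (t : R) (p : jordan R * jordan R) : jordan R * jordan R :=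
  pinv cayley_cotangent0 tauO (phiC t (tauO p)).

End TheFlow.

Section JordanTheory.
Context {R : realType}.
Implicit Types (x y : 'rV[R]_8) (X Y : jordan R) (M N : 'M['rV[R]_8]_3).

Lemma ord3E (P : 'I_3 -> Prop) : P 0 -> P 1 -> P 2 -> forall i, P i.
Proof.
move=> P0 P1 P2 [[|[|[|//]]] lt_i].
- by rewrite (_ : Ordinal lt_i = 0) //; apply: val_inj.
- by rewrite (_ : Ordinal lt_i = 1) //; apply: val_inj.
- by rewrite (_ : Ordinal lt_i = 2) //; apply: val_inj.
Qed.

Lemma jmxK : cancel (@jmx R) omx_to_j.
Proof.
case=> xi x; congr pair.
  by apply/rowP; elim/ord3E; rewrite !mxE/= ?mxE/= mulr1.
by apply/matrixP => i k; elim/ord3E: i; rewrite !mxE/= ?mxE.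
Qed.

Lemma oconjK : involutive (@oconj R).
Proof.
by move=> x; apply/rowP => k; rewrite !mxE; case: (k == 0) => //=; rewrite opprK.
Qed.

Lemma oconj_real (r : R) : oconj (oreal r) = oreal r.
Proof.
apply/rowP => k; rewrite !mxE eqxx/=.
by case: (k == 0) => //=; rewrite mulr0 oppr0.
Qed.

Lemma jmx_herm X : omx_herm (jmx X).
Proof.
apply/matrixP => i j; elim/ord3E: i; elim/ord3E: j; rewrite !mxE/=;
  by rewrite ?oconj_real ?oconjK.
Qed.

Lemma omx_to_jK M : omx_herm M -> jmx (omx_to_j M) = M.
Proof.
move=> hM; have E i j : oconj (M j i) = M i j.
  by move/matrixP: hM => /(_ i j); rewrite !mxE.
have D i : oreal (M i i 0 0) = M i i.
  apply/rowP => k; have /rowP/(_ k) := E i i; rewrite !mxE eqxx /=.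
  case: eqP => [->|_]; first by rewrite mulr1.
  by move=> h; rewrite mulr0; lra.
have F i : row i (omx_to_j M).2 = M (i + 1) (i + 2).
  by apply/rowP => k; rewrite !mxE.
have I (a b : 'I_3) : val a = val b -> a = b by exact: val_inj.
apply/matrixP => i j; elim/ord3E: i; elim/ord3E: j;
  rewrite mxE /= ?F ?mxE ?D ?E //; congr (M _ _); exact: I.
Qed.

Lemma ord4E (P : 'I_4 -> Prop) : P 0 -> P 1 -> P 2 -> P 3 -> forall i, P i.
Proof.
move=> P0 P1 P2 P3 [[|[|[|[|//]]]] lt_i].
- by rewrite (_ : Ordinal lt_i = 0) //; apply: val_inj.
- by rewrite (_ : Ordinal lt_i = 1) //; apply: val_inj.
- by rewrite (_ : Ordinal lt_i = 2) //; apply: val_inj.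
- by rewrite (_ : Ordinal lt_i = 3) //; apply: val_inj.
Qed.

Lemma qconjM (a b : 'rV[R]_4) : qconj (qmul a b) = qmul (qconj b) (qconj a).
Proof. by apply/rowP; elim/ord4E; rewrite !mxE /= ?mxE /=; ring. Qed.

Lemma qmulNN (a b : 'rV[R]_4) : qmul (- a) (- b) = qmul a b.
Proof. by apply/rowP; elim/ord4E; rewrite !mxE /= ?mxE /=; ring. Qed.

Lemma qmulN (a b : 'rV[R]_4) : qmul (- a) b = - qmul a b.
Proof. by apply/rowP; elim/ord4E; rewrite !mxE /= ?mxE /=; ring. Qed.

Lemma qconjK : involutive (@qconj R).
Proof.
by move=> x; apply/rowP => k; rewrite !mxE; case: (k == 0) => //=; rewrite opprK.
Qed.

Lemma qconjD (a b : 'rV[R]_4) : qconj (a + b) = qconj a + qconj b.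
Proof.
by apply/rowP => k; rewrite !mxE; case: (k == 0) => //=; rewrite opprD.
Qed.

Lemma qconjN (a : 'rV[R]_4) : qconj (- a) = - qconj a.
Proof. by apply/rowP => k; rewrite !mxE; case: (k == 0). Qed.

Lemma lsub_oconj x :
  lsubmx (oconj x : 'rV_(4 + 4)) = qconj (lsubmx (x : 'rV_(4 + 4))).
Proof. by apply/rowP => k; rewrite !mxE. Qed.

Lemma rsub_oconj x :
  rsubmx (oconj x : 'rV_(4 + 4)) = - rsubmx (x : 'rV_(4 + 4)).
Proof. by apply/rowP => k; rewrite !mxE. Qed.

Lemma oconjM x y : oconj (omul x y) = omul (oconj y) (oconj x).
Proof.
rewrite -[LHS](@hsubmxK R 1 4 4) lsub_oconj rsub_oconj /omul.
rewrite !row_mxKl !row_mxKr !lsub_oconj !rsub_oconj.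
apply: (f_equal2 (@row_mx R 1 4 4)).
  by rewrite qconjD qconjN !qconjM qconjK qconjN qmulNN.
by rewrite opprD qconjK !qmulN addrC.
Qed.

Lemma oconjD x y : oconj (x + y) = oconj x + oconj y.
Proof.
by apply/rowP => k; rewrite !mxE; case: (k == 0) => //=; rewrite opprD.
Qed.

Lemma oconjZ (r : R) x : oconj (r *: x) = r *: oconj x.
Proof.
by apply/rowP => k; rewrite !mxE; case: (k == 0) => //=; rewrite mulrN.
Qed.

Lemma omx_jordan_herm M N :
  omx_herm M -> omx_herm N -> omx_herm (omx_jordan M N).
Proof.
move=> hM hN; have E i j : oconj (M j i) = M i j.
  by move/matrixP: hM => /(_ i j); rewrite !mxE.
have F i j : oconj (N j i) = N i j.
  by move/matrixP: hN => /(_ i j); rewrite !mxE.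
have oconj0 : oconj (0 : 'rV[R]_8) = 0.
  by apply/rowP => k; rewrite !mxE oppr0 if_same.
have G i j (A B : 'M['rV[R]_8]_3) : (forall i j, oconj (A j i) = A i j) ->
    (forall i j, oconj (B j i) = B i j) ->
    oconj (omulmx A B j i) = omulmx B A i j.
  move=> hA hB; rewrite !mxE (big_morph _ oconjD oconj0).
  by apply: eq_bigr => k _; rewrite oconjM hA hB.
apply/matrixP => i j; rewrite /omx_jordan mxE mxE mxE [RHS]mxE oconjZ.
have S (A B : 'M['rV[R]_8]_3) a b : (A + B) a b = A a b + B a b.
  by rewrite mxE.
by congr (_ *: _); rewrite !S oconjD !G // addrC.
Qed.

Lemma jmx_jmul X Y : jmx (jmul X Y) = omx_jordan (jmx X) (jmx Y).
Proof. by apply: omx_to_jK; apply: omx_jordan_herm; apply: jmx_herm. Qed.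

Lemma ord8_sum (F : 'I_8 -> R) :
  \sum_(k < 8) F k
  = F 0 + F 1 + F 2 + F 3 + F 4 + F 5 + F 6 + F 7.
Proof.
rewrite !big_ord_recl big_ord0 addr0 !addrA.
by congr (F _ + F _ + F _ + F _ + F _ + F _ + F _ + F _); apply: val_inj.
Qed.

Lemma omul_oconj_re x y : omul x (oconj y) 0 0 = odot x y.
Proof.
have Q a b : qmul a b 0 0 = a 0 0 * b 0 0 - a 0 1 * b 0 1
    - a 0 2 * b 0 2 - a 0 3 * b 0 3 :> R by rewrite mxE.
have C (a : 'rV[R]_4) :
    (qconj a 0 0 = a 0 0) * (qconj a 0 1 = - a 0 1)
    * (qconj a 0 2 = - a 0 2) * (qconj a 0 3 = - a 0 3) by rewrite !mxE.
have L (z : 'rV[R]_8) (k : 'I_4) :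
    lsubmx (z : 'rV_(4 + 4)) 0 k = z 0 (lshift 4 k) by rewrite mxE.
have K (z : 'rV[R]_8) (k : 'I_4) :
    rsubmx (z : 'rV_(4 + 4)) 0 k = z 0 (rshift 4 k) by rewrite mxE.
have N (a : 'rV[R]_4) k : (- a) 0 k = - a 0 k by rewrite mxE.
have B (a b : 'rV[R]_4) k : (a - b) 0 k = a 0 k - b 0 k by rewrite !mxE.
rewrite /omul lsub_oconj rsub_oconj /odot ord8_sum.
have Z (u v : 'rV[R]_4) : (row_mx u v : 'rV_8) 0 0 = u 0 0.
  by rewrite -(row_mxEl u v 0 0); congr (row_mx u v 0 _); apply: val_inj.
rewrite [LHS]Z B !Q !C !N !L !K.
rewrite (_ : @lshift 4 4 0 = (0 : 'I_8)); last exact: val_inj.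
rewrite (_ : @lshift 4 4 1 = (1 : 'I_8)); last exact: val_inj.
rewrite (_ : @lshift 4 4 2 = (2 : 'I_8)); last exact: val_inj.
rewrite (_ : @lshift 4 4 3 = (3 : 'I_8)); last exact: val_inj.
rewrite (_ : @rshift 4 4 0 = (4 : 'I_8)); last exact: val_inj.
rewrite (_ : @rshift 4 4 1 = (5 : 'I_8)); last exact: val_inj.
rewrite (_ : @rshift 4 4 2 = (6 : 'I_8)); last exact: val_inj.
rewrite (_ : @rshift 4 4 3 = (7 : 'I_8)); last exact: val_inj.
ring.
Qed.

Lemma odot_conj x y : odot (oconj x) (oconj y) = odot x y.
Proof.
by apply: eq_bigr => k _; rewrite !mxE; case: (k == 0) => //; rewrite mulrNN.
Qed.

Lemma odotC x y : odot x y = odot y x.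
Proof. by apply: eq_bigr => k _; rewrite mulrC. Qed.

Lemma odot_real (r s : R) : odot (oreal r) (oreal s) = r * s.
Proof.
rewrite /odot (bigD1 0) //= big1 ?addr0 => [|k /negbTE k0].
  by rewrite !mxE/= !mulr1.
by rewrite !mxE k0 /= !mulr0.
Qed.

Lemma jdotE X Y :
  jdot X Y = \sum_(i < 3) (X.1 0 i * Y.1 0 i
                           + 2 * odot (row i X.2) (row i Y.2)).
Proof.
have H (Z : jordan R) i j : jmx Z i j = oconj (jmx Z j i).
  by have /matrixP/(_ i j) := jmx_herm Z; rewrite !mxE => ->.
have S (X' Y' : jordan R) i :
    omulmx (jmx X') (jmx Y') i i 0 0 = \sum_k odot (jmx X' i k) (jmx Y' i k).
  rewrite mxE summxE; apply: eq_bigr => k _.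
  by rewrite (H Y') omul_oconj_re.
have T i : (jmul X Y).1 0 i = \sum_k odot (jmx X i k) (jmx Y i k).
  have A (r : R) (M N : 'M['rV[R]_8]_3) a :
      map_mx ( *:%R r) (M + N) a a 0 0 = r * (M a a 0 0 + N a a 0 0).
    by rewrite !mxE.
  rewrite mxE A !S [X in _ + X](eq_bigr _ (fun k _ => odotC _ _)).
  by field.
have O (F : 'I_3 -> R) : \sum_i F i = F 0 + F 1 + F 2.
  rewrite !big_ord_recl big_ord0 addr0 addrA.
  by congr (F _ + F _ + F _); apply: val_inj.
rewrite /jdot /jtr (eq_bigr _ (fun i _ => T i)) !O /jmx !mxE /=.
rewrite !odot_conj !odot_real.
by ring.
Qed.

End JordanTheory.

(* Main.v *)
Require Import Defs.
From HB Require Import structures.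
From mathcomp Require Import all_boot all_order all_algebra.
From mathcomp Require Import all_classical all_reals all_analysis.
From mathcomp Require Import complex ring lra.
Import Order.TTheory GRing.Theory Num.Theory.
Import numFieldNormedType.Exports.
Local Open Scope classical_set_scope.
Local Open Scope ring_scope.

Set Implicit Arguments.
Unset Strict Implicit.
Unset Printing Implicit Defensive.

(** Two independent computations meet in this theorem.

    On the linear space of pairs A = U + i V, put s = |A|^(1/2).  Differentiating
    the potential s twice gives the form explicitly (omega_snorm): writing J for
    multiplication by i and <,> for the real inner product,
      omega(u, v) = sqrt 2 (<u, J v> / (2 s^3)
        - 3 (<A, u> <A, J v> - <A, v> <A, J u>) / (8 s^7)).
    Closedness is then an identity between first derivatives (domegaR_cycle).
    Nondegeneracy holds because omega(u, J u) is, up to a positive factor,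
    3 |h|^2 - 4 |A|^2 |u|^2 where h = <A, u> + i <A, J u> is bounded by
    |h| <= |A| |u| (hermitian_bessel).  Contracting omega with the velocity
    -2 J A of the rotation exp(-2 i t) A leaves only a multiple of <A, .>, namely
    minus the differential of s / sqrt 2 (omegaR_phiC_field).  Every set of
    nonzero vectors that is stable under the rotation inherits this
    (phiC_hamiltonian); the cone A o A = 0 is such a set because the product is
    complex bilinear.

    The algebra behind tau is governed by two facts about the Jordan product: the
    form (X o Y, Z) is symmetric in its three arguments (jdotA) and every X
    satisfies its cubic characteristic equation (cayley_hamilton).  Polarizing the
    cubic (polarized_identity) at an idempotent X of trace 1 and a Y with
    X o Y = Y / 2 gives, with n = |Y|^2,
      X o Y^2 = (n / 2) X,  Y o Y^2 = (n / 2) Y,  Y^2 o Y^2 = (n / 2) Y^2,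
    and these three relations say that tau (X, Y) squares to zero.  Conversely, if
    A = U + i V squares to zero then the polarized cubic forces (tr A)^4 = 0
    (null_tr); so U and V are traceless, satisfy the last two relations
    themselves, and the inverse of tau can be written down and checked.

    Applying that inverse to the rotated point exp(-2 i t) tau (X, Y) keeps Y^2
    fixed, so the transported flow is linear in cos 2t and sin 2t (flow).  With
    r = |Y|_P and Z = n X - Y^2 its velocity is (Y / r, - (2 / r) Z).  Both X and
    Y^2 are orthogonal to the tangent space at X, hence so is Z (tau_re_orth).
    This one orthogonality gives Hamilton's equations for r, and, when r = 1, says
    that the acceleration of the curve X(t) is normal to the projective plane. *)

(** * Octonion identities *)
Section OctonionIdentities.
Context {R : realType}.
Implicit Types (x y z : 'rV[R]_8) (a b c d : 'rV[R]_4) (t : R).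

(** Explicit coordinates: on rows built by quat and oct all octonion operations
    become rewriting rules, and identities reduce to polynomial identities. *)
Definition quat (t0 t1 t2 t3 : R) : 'rV[R]_4 :=
  \row_(k < 4) nth 0 [:: t0; t1; t2; t3] k.

Definition oct a b : 'rV[R]_8 := row_mx a b.

Lemma quatE a : a = quat (a 0 0) (a 0 1) (a 0 2) (a 0 3).
Proof. by apply/rowP; elim/ord4E; rewrite mxE. Qed.

Lemma octE x :
  x = oct (lsubmx (x : 'rV_(4 + 4))) (rsubmx (x : 'rV_(4 + 4))).
Proof. by rewrite -[LHS](@hsubmxK R 1 4 4). Qed.

Lemma quatM t0 t1 t2 t3 s0 s1 s2 s3 :
  qmul (quat t0 t1 t2 t3) (quat s0 s1 s2 s3) =
  quat (t0 * s0 - t1 * s1 - t2 * s2 - t3 * s3)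
       (t0 * s1 + t1 * s0 + t2 * s3 - t3 * s2)
       (t0 * s2 - t1 * s3 + t2 * s0 + t3 * s1)
       (t0 * s3 + t1 * s2 - t2 * s1 + t3 * s0).
Proof. by apply/rowP; elim/ord4E; rewrite !mxE. Qed.

Lemma quat_conj t0 t1 t2 t3 :
  qconj (quat t0 t1 t2 t3) = quat t0 (- t1) (- t2) (- t3).
Proof. by apply/rowP; elim/ord4E; rewrite !mxE. Qed.

Lemma quatD t0 t1 t2 t3 s0 s1 s2 s3 :
  quat t0 t1 t2 t3 + quat s0 s1 s2 s3 =
  quat (t0 + s0) (t1 + s1) (t2 + s2) (t3 + s3).
Proof. by apply/rowP; elim/ord4E; rewrite !mxE. Qed.

Lemma quatN t0 t1 t2 t3 :
  - quat t0 t1 t2 t3 = quat (- t0) (- t1) (- t2) (- t3).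
Proof. by apply/rowP; elim/ord4E; rewrite !mxE. Qed.

Lemma quatZ t t0 t1 t2 t3 :
  t *: quat t0 t1 t2 t3 = quat (t * t0) (t * t1) (t * t2) (t * t3).
Proof. by apply/rowP; elim/ord4E; rewrite !mxE. Qed.

Definition quat_simp := (quatM, quat_conj, quatN, quatD, quatZ).

Lemma octM a b c d :
  omul (oct a b) (oct c d)
  = oct (qmul a c - qmul (qconj d) b) (qmul d a + qmul b (qconj c)).
Proof. by rewrite /omul !row_mxKl !row_mxKr. Qed.

Lemma oct_conj a b : oconj (oct a b) = oct (qconj a) (- b).
Proof. by rewrite [LHS]octE lsub_oconj rsub_oconj !row_mxKl !row_mxKr. Qed.

Lemma split_ord_ind m n (P : 'I_(m + n) -> Prop) :
  (forall i, P (lshift n i)) -> (forall i, P (rshift m i)) -> forall k, P k.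
Proof. by move=> Pl Pr k; case: (split_ordP k) => i ->. Qed.

Lemma octEl a b k : oct a b 0 (@lshift 4 4 k) = a 0 k.
Proof. exact: (@row_mxEl R 1 4 4). Qed.

Lemma octEr a b k : oct a b 0 (@rshift 4 4 k) = b 0 k.
Proof. exact: (@row_mxEr R 1 4 4). Qed.

Lemma octD a b c d : oct a b + oct c d = oct (a + c) (b + d).
Proof.
by apply/rowP; apply: (@split_ord_ind 4 4) => k;
  rewrite mxE ?octEl ?octEr mxE.
Qed.

Lemma octZ t a b : t *: oct a b = oct (t *: a) (t *: b).
Proof.
by apply/rowP; apply: (@split_ord_ind 4 4) => k;
  rewrite mxE ?octEl ?octEr mxE.
Qed.

Lemma oct_dot a b c d :
  odot (oct a b) (oct c d)
  = \sum_(k < 4) a 0 k * c 0 k + \sum_(k < 4) b 0 k * d 0 k.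
Proof.
rewrite /odot (@big_split_ord _ _ _ 4 4) /=.
by congr (_ + _); apply: eq_bigr => k _; rewrite ?octEl ?octEr.
Qed.

Lemma quat_dot t0 t1 t2 t3 s0 s1 s2 s3 :
  \sum_(k < 4) quat t0 t1 t2 t3 0 k * quat s0 s1 s2 s3 0 k
  = t0 * s0 + t1 * s1 + t2 * s2 + t3 * s3.
Proof. by rewrite !big_ord_recl big_ord0 addr0 !addrA !mxE. Qed.

Definition oct_simp := (octM, oct_conj, octD, octZ, oct_dot).

Lemma oct_ind (P : 'rV[R]_8 -> Prop) :
  (forall t0 t1 t2 t3 t4 t5 t6 t7,
      P (oct (quat t0 t1 t2 t3) (quat t4 t5 t6 t7))) ->
  forall x, P x.
Proof. by move=> Poct x; rewrite [x]octE [lsubmx _]quatE [rsubmx _]quatE. Qed.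

(** The alternative law, in the only form needed: right multiplication by conj x
    and then by x is multiplication by |x|^2. *)
Lemma omul_conjK x z : omul (omul z (oconj x)) x = odot x x *: z.
Proof.
elim/oct_ind: x => *; elim/oct_ind: z => *.
rewrite !oct_simp !quat_simp !quat_dot.
by apply: f_equal2; apply: f_equal4; ring.
Qed.

(** The real part of (x y) z is invariant under cyclic permutations although the
    product is not associative.  The symmetry of the trilinear form of the Jordan
    algebra comes from this. *)
Lemma odot_omul_cycle x y z :
  odot (omul x y) (oconj z) = odot (omul y z) (oconj x).
Proof.
elim/oct_ind: x => *; elim/oct_ind: y => *; elim/oct_ind: z => *.
by rewrite !oct_simp !quat_simp !quat_dot; ring.
Qed.

Lemma omulDl x y z : omul (x + y) z = omul x z + omul y z.
Proof.
elim/oct_ind: x => *; elim/oct_ind: y => *; elim/oct_ind: z => *.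
rewrite !oct_simp !quat_simp.
by apply: f_equal2; apply: f_equal4; ring.
Qed.

Lemma omulZl t x y : omul (t *: x) y = t *: omul x y.
Proof.
elim/oct_ind: x => *; elim/oct_ind: y => *.
rewrite !oct_simp !quat_simp.
by apply: f_equal2; apply: f_equal4; ring.
Qed.

End OctonionIdentities.

(** * The Jordan product in coordinates *)
Section JordanProduct.
Context {R : realType}.
Implicit Types (x y z : 'rV[R]_8) (X Y Z : jordan R) (p q r s t : R).

(** In the matrix jmx the octonions x, y, z stand at the positions (2,3), (3,1),
    (1,2). *)
Definition jor p q r x y z : jordan R :=
  (\row_(i < 3) nth 0 [:: p; q; r] i,
   \matrix_(i < 3, k < 8) nth 0 [:: x; y; z] i 0 k).

Lemma jor_eq p q r x y z p' q' r' x' y' z' :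
  p = p' -> q = q' -> r = r' -> x = x' -> y = y' -> z = z' ->
  jor p q r x y z = jor p' q' r' x' y' z'.
Proof. by do 6! move=> ->. Qed.

Lemma jor_ind (P : jordan R -> Prop) :
  (forall p q r x y z, P (jor p q r x y z)) -> forall X, P X.
Proof.
move=> Pjor [xi x].
have -> : (xi, x)
    = jor (xi 0 0) (xi 0 1) (xi 0 2) (row 0 x) (row 1 x) (row 2 x).
  congr pair; first by apply/rowP; elim/ord3E; rewrite mxE.
  by apply/matrixP => i k; elim/ord3E: i; rewrite !mxE.
exact: Pjor.
Qed.

Lemma jorD p q r x y z p' q' r' x' y' z' :
  jor p q r x y z + jor p' q' r' x' y' z'
  = jor (p + p') (q + q') (r + r') (x + x') (y + y') (z + z').
Proof.
congr pair; first by apply/rowP; elim/ord3E; rewrite !mxE.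
by apply/matrixP => i k; elim/ord3E: i; rewrite !mxE.
Qed.

Lemma jorN p q r x y z :
  - jor p q r x y z = jor (- p) (- q) (- r) (- x) (- y) (- z).
Proof.
congr pair; first by apply/rowP; elim/ord3E; rewrite !mxE.
by apply/matrixP => i k; elim/ord3E: i; rewrite !mxE.
Qed.

Lemma jorZ t p q r x y z :
  t *: jor p q r x y z = jor (t * p) (t * q) (t * r) (t *: x) (t *: y) (t *: z).
Proof.
congr pair; first by apply/rowP; elim/ord3E; rewrite !mxE.
by apply/matrixP => i k; elim/ord3E: i; rewrite !mxE.
Qed.

Lemma jor_tr p q r x y z : jtr (jor p q r x y z) = p + q + r.
Proof. by rewrite /jtr !big_ord_recl big_ord0 addr0 addrA !mxE. Qed.

Lemma jor_dot p q r x y z p' q' r' x' y' z' :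
  jdot (jor p q r x y z) (jor p' q' r' x' y' z')
  = p * p' + q * q' + r * r' + 2 * (odot x x' + odot y y' + odot z z').
Proof.
have rowE (i : 'I_3) a b c u v w :
    row i (jor a b c u v w).2 = nth 0 [:: u; v; w] i.
  by apply/rowP => k; rewrite !mxE.
rewrite jdotE !big_ord_recl big_ord0 addr0 !rowE !mxE /=.
ring.
Qed.

Lemma omul_real t x : omul (oreal t) x = t *: x.
Proof.
have -> : oreal t = oct (quat t 0 0 0) (quat 0 0 0 0).
  apply/rowP; apply: (@split_ord_ind 4 4) => k;
    rewrite ?octEl ?octEr; elim/ord4E: k; rewrite !mxE /= ?mulr1 ?mulr0 //.
elim/(@oct_ind R): x => *; rewrite !oct_simp !quat_simp.
by apply: f_equal2; apply: f_equal4; ring.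
Qed.

Lemma omul_realr t x : omul x (oreal t) = t *: x.
Proof. by rewrite -[LHS]oconjK oconjM oconj_real omul_real oconjZ oconjK. Qed.

Lemma omul_re x y : omul x y 0 0 = odot x (oconj y).
Proof. by rewrite -omul_oconj_re oconjK. Qed.

Definition mx3 (a b c d e f g h k : 'rV[R]_8) : 'M['rV[R]_8]_3 :=
  \matrix_(i < 3, j < 3)
    nth 0 (nth [::] [:: [:: a; b; c]; [:: d; e; f]; [:: g; h; k]] i) j.

Lemma mx3M a b c d e f g h k a' b' c' d' e' f' g' h' k' :
  omulmx (mx3 a b c d e f g h k) (mx3 a' b' c' d' e' f' g' h' k')
  = mx3 (omul a a' + omul b d' + omul c g') (omul a b' + omul b e' + omul c h')
        (omul a c' + omul b f' + omul c k')
        (omul d a' + omul e d' + omul f g') (omul d b' + omul e e' + omul f h')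
        (omul d c' + omul e f' + omul f k')
        (omul g a' + omul h d' + omul k g') (omul g b' + omul h e' + omul k h')
        (omul g c' + omul h f' + omul k k').
Proof.
apply/matrixP => i j; rewrite mxE !big_ord_recl big_ord0 addr0 addrA.
by elim/ord3E: i; elim/ord3E: j; rewrite !mxE.
Qed.

Lemma mx3_half a b c d e f g h k a' b' c' d' e' f' g' h' k' :
  map_mx ( *:%R (2^-1 : R))
    (mx3 a b c d e f g h k + mx3 a' b' c' d' e' f' g' h' k')
  = mx3 (2^-1 *: (a + a')) (2^-1 *: (b + b')) (2^-1 *: (c + c'))
        (2^-1 *: (d + d')) (2^-1 *: (e + e')) (2^-1 *: (f + f'))
        (2^-1 *: (g + g')) (2^-1 *: (h + h')) (2^-1 *: (k + k')).
Proof. by apply/matrixP => i j; elim/ord3E: i; elim/ord3E: j; rewrite !mxE. Qed.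

Lemma mx3_to_j a b c d e f g h k :
  omx_to_j (mx3 a b c d e f g h k) = jor (a 0 0) (e 0 0) (k 0 0) f g b.
Proof.
congr pair; first by apply/rowP; elim/ord3E; rewrite !mxE.
by apply/matrixP => i l; elim/ord3E: i; rewrite !mxE.
Qed.

Lemma jmx_jor p q r x y z :
  jmx (jor p q r x y z)
  = mx3 (oreal p) z (oconj y) (oconj z) (oreal q) x y (oconj x) (oreal r).
Proof.
have rowE (i : 'I_3) a b c u v w :
    row i (jor a b c u v w).2 = nth 0 [:: u; v; w] i.
  by apply/rowP => k; rewrite !mxE.
by apply/matrixP => i j; elim/ord3E: i; elim/ord3E: j;
  rewrite [LHS]mxE [RHS]mxE /= ?rowE ?mxE.
Qed.

Lemma rowvD (u v : 'rV[R]_8) : (u + v) 0 0 = u 0 0 + v 0 0.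
Proof. by rewrite mxE. Qed.

Lemma rowvZ t (u : 'rV[R]_8) : (t *: u) 0 0 = t * u 0 0.
Proof. by rewrite mxE. Qed.

Lemma oreal_re t : oreal t 0 0 = t :> R.
Proof. by rewrite !mxE mulr1. Qed.

Lemma jor_mul p q r x y z p' q' r' x' y' z' :
  jmul (jor p q r x y z) (jor p' q' r' x' y' z')
  = jor (p * p' + odot y y' + odot z z')
        (q * q' + odot z z' + odot x x')
        (r * r' + odot x x' + odot y y')
        (2^-1 *: ((q + r) *: x' + (q' + r') *: x
                  + oconj (omul y' z) + oconj (omul y z')))
        (2^-1 *: ((r + p) *: y' + (r' + p') *: y
                  + oconj (omul z' x) + oconj (omul z x')))
        (2^-1 *: ((p + q) *: z' + (p' + q') *: z
                  + oconj (omul x' y) + oconj (omul x y'))).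
Proof.
rewrite /jmul /omx_jordan !jmx_jor !mx3M mx3_half mx3_to_j.
rewrite !(omul_real, omul_realr) !oconjM.
apply: jor_eq.
1-3: by rewrite !(oreal_re, rowvD, rowvZ);
  rewrite ?omul_re ?oconj_real ?oconjK ?odot_conj;
  rewrite ?(odotC _ x) ?(odotC _ y) ?(odotC _ z); field.
all: do 2! move: (omul _ _) => ?; apply/rowP => k; rewrite !mxE; ring.
Qed.

Lemma odotDl x y z : odot (x + y) z = odot x z + odot y z.
Proof.
by rewrite /odot -big_split; apply: eq_bigr => k _; rewrite mxE mulrDl.
Qed.

Lemma odotZl t x y : odot (t *: x) y = t * odot x y.
Proof.
by rewrite /odot mulr_sumr; apply: eq_bigr => k _; rewrite mxE mulrA.
Qed.

Lemma odotDr x y z : odot x (y + z) = odot x y + odot x z.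
Proof. by rewrite !(odotC x) odotDl. Qed.

Lemma odotZr t x y : odot x (t *: y) = t * odot x y.
Proof. by rewrite !(odotC x) odotZl. Qed.

Definition odot_lin := (odotDl, odotZl, odotDr, odotZr).

Lemma omulDr x y z : omul x (y + z) = omul x y + omul x z.
Proof. by rewrite -[LHS]oconjK oconjM oconjD omulDl oconjD !oconjM !oconjK. Qed.

Lemma omulZr t x y : omul x (t *: y) = t *: omul x y.
Proof. by rewrite -[LHS]oconjK oconjM oconjZ omulZl oconjZ oconjM !oconjK. Qed.

Lemma odot_conjC x y : odot (oconj x) y = odot x (oconj y).
Proof. by rewrite -[RHS]odot_conj oconjK. Qed.

Lemma jmul_comm X Y : jmul X Y = jmul Y X.
Proof.
elim/(@jor_ind): X => p q r x y z; elim/(@jor_ind): Y => p' q' r' x' y' z'.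
rewrite !jor_mul; apply: jor_eq.
1-3: by rewrite ?(odotC x) ?(odotC y) ?(odotC z) [in LHS]mulrC.
all: do 2! move: (oconj (omul _ _)) => ?; apply/rowP => k; rewrite !mxE; ring.
Qed.

Lemma jmulDl X Y Z : jmul (X + Y) Z = jmul X Z + jmul Y Z.
Proof.
elim/(@jor_ind): X => p q r x y z; elim/(@jor_ind): Y => p' q' r' x' y' z'.
elim/(@jor_ind): Z => u v w a b c.
rewrite jorD !jor_mul jorD !(omulDl, omulDr, odot_lin, oconjD).
apply: jor_eq.
1-3: ring.
all: do 4! move: (oconj (omul _ _)) => ?; apply/rowP => k; rewrite !mxE; ring.
Qed.

Lemma jmulZl t X Y : jmul (t *: X) Y = t *: jmul X Y.
Proof.
elim/(@jor_ind): X => p q r x y z; elim/(@jor_ind): Y => p' q' r' x' y' z'.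
rewrite jorZ !jor_mul jorZ !(omulZl, omulZr, odot_lin, oconjZ).
apply: jor_eq.
1-3: ring.
all: do 2! move: (oconj (omul _ _)) => ?; apply/rowP => k; rewrite !mxE; ring.
Qed.

Lemma jdot_comm X Y : jdot X Y = jdot Y X.
Proof. by rewrite /jdot jmul_comm. Qed.

(** The octonion terms on both sides are real parts of products of three entries,
    one from each argument and one at each off-diagonal position; they agree up to
    cyclic permutation. *)
Lemma jdotA X Y Z : jdot (jmul X Y) Z = jdot X (jmul Y Z).
Proof.
elim/(@jor_ind): X => p q r x y z; elim/(@jor_ind): Y => p' q' r' x' y' z'.
elim/(@jor_ind): Z => u v w a b c.
have tri (e f g : 'rV[R]_8) :
    odot g (oconj (omul e f)) = odot (omul e f) (oconj g).
  by rewrite -odot_conjC odotC.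
rewrite !jor_mul !jor_dot !odot_lin !(odotC (oconj _)) !tri.
rewrite (odotC x x') (odotC y y') (odotC z z').
rewrite (odot_omul_cycle b) (odot_omul_cycle c x') (odot_omul_cycle a).
rewrite -(odot_omul_cycle x y') -(odot_omul_cycle y z') -(odot_omul_cycle z x').
by field.
Qed.

Definition jone : jordan R := jor 1 1 1 0 0 0.

Lemma odot0 x : odot x 0 = 0.
Proof. by rewrite -(scale0r x) odotZr mul0r. Qed.

Lemma omul0 x : omul x 0 = 0.
Proof. by rewrite -(scale0r x) omulZr !scale0r. Qed.

Lemma oconj0 : oconj 0 = 0 :> 'rV[R]_8.
Proof. by rewrite -(scale0r 0) oconjZ !scale0r. Qed.

Lemma omul0l x : omul 0 x = 0.
Proof. by rewrite -(scale0r x) omulZl !scale0r. Qed.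

Lemma jmul1 X : jmul X jone = X.
Proof.
elim/(@jor_ind): X => p q r x y z.
rewrite /jone jor_mul !odot0 !omul0 !omul0l oconj0; apply: jor_eq.
1-3: ring.
all: apply/rowP => k; rewrite !mxE; by field.
Qed.

Lemma jdot1 X : jdot X jone = jtr X.
Proof. by rewrite /jdot jmul1. Qed.

(** The determinant expressed through power traces (Newton's identities), which
    avoids a triple product of octonions. *)
Definition jdet X : R :=
  jdot X (jmul X X) / 3 - jtr X * jdot X X / 2 + jtr X ^+ 3 / 6.

Lemma omulK_conj x z : omul (omul z x) (oconj x) = odot x x *: z.
Proof. by rewrite -{1}(oconjK x) omul_conjK odot_conj. Qed.

End JordanProduct.

(** * The cubic characteristic equation *)
Section CayleyHamilton.
Context {R : realType}.
Implicit Types (x y z : 'rV[R]_8) (X : jordan R) (p q r t : R).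

(** The off-diagonal entries of a square. *)
Definition jsq_off q r x y z : 'rV[R]_8 :=
  (q + r) *: x + oconj (omul y z).

(** Non-associative products occur in the cube of a matrix only with a repeated
    factor, where the alternative law evaluates them. *)
Lemma off_left r p x y z :
  oconj (omul (jsq_off r p y z x) z)
  = (r + p) *: oconj (omul y z) + odot z z *: x.
Proof.
by rewrite /jsq_off (oconjM z x) omulDl omulZl omul_conjK oconjD !oconjZ oconjK.
Qed.

Lemma off_right p q x y z :
  oconj (omul y (jsq_off p q z x y))
  = (p + q) *: oconj (omul y z) + odot y y *: x.
Proof.
rewrite /jsq_off oconjM oconjD oconjZ oconjK omulDl omulZl omulK_conj.
by rewrite (oconjM y z).
Qed.

Lemma jor_sq p q r x y z :
  jmul (jor p q r x y z) (jor p q r x y z)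
  = jor (p ^+ 2 + odot y y + odot z z) (q ^+ 2 + odot z z + odot x x)
        (r ^+ 2 + odot x x + odot y y)
        (jsq_off q r x y z) (jsq_off r p y z x) (jsq_off p q z x y).
Proof.
rewrite jor_mul /jsq_off; apply: jor_eq; rewrite ?expr2 //.
all: move: (oconj (omul _ _)) => ?; apply/rowP => k; rewrite !mxE; by field.
Qed.

Lemma odot_sq_off q r x y z :
  odot x (jsq_off q r x y z)
  = (q + r) * odot x x + odot (omul y z) (oconj x).
Proof.
rewrite /jsq_off odotDr odotZr.
by rewrite -[in X in _ + X]odot_conjC [in X in _ + X]odotC.
Qed.

(** After the alternative law and the cyclic symmetry have been applied to the
    entries of X o X^2, the equation holds in each entry as a polynomial identity
    in which the octonion products are independent variables. *)
Lemma cayley_hamilton X :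
  jmul X (jmul X X) = jtr X *: jmul X X
    - ((jtr X ^+ 2 - jdot X X) / 2) *: X + jdet X *: jone.
Proof.
rewrite /jdet; elim/(@jor_ind): X => p q r x y z.
rewrite jor_sq !jor_dot !jor_tr /jone jor_mul !odot_sq_off.
move: (odot_omul_cycle y z x) (odot_omul_cycle z x y).
move: (off_left r p x y z) (off_right p q x y z).
move: (off_left p q y z x) (off_right q r y z x).
move: (off_left q r z x y) (off_right r p z x y).
(* From here on only the identities just listed matter, so the octonion
   operations are replaced by variables. *)
move: (erefl (jsq_off q r x y z)) (erefl (jsq_off r p y z x)).
move: (erefl (jsq_off p q z x y)); rewrite {2 4 6}/jsq_off.
move: (odot x x) (odot y y) (odot z z) (odot (omul x y) _).
move: (odot (omul y z) _) (odot (omul z x) _).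
move: (jsq_off q r x y z) (jsq_off r p y z x) (jsq_off p q z x y).
move: (@omul R) (@oconj R) => m c yz zx xy tx ty nx ny nz t.
move=> exy eyz ezx e1 e2 e3 e4 e5 e6 -> ->.
rewrite {}e1 {}e2 {}e3 {}e4 {}e5 {}e6 {xy}exy {yz}eyz {zx}ezx.
move: (c (m y z)) (c (m z x)) (c (m x y)) => yz zx xy.
rewrite !jorZ jorN !jorD; apply: jor_eq.
1-3: by field.
all: apply/rowP => k; rewrite !mxE; by field.
Qed.

End CayleyHamilton.

(** * Consequences of the cubic equation *)
Section CubicAlgebra.
Context {R : realFieldType} {V : lmodType R}.
Context (mul : V -> V -> V) (dot : V -> V -> R) (one : V).
Local Notation "x ** y" := (mul x y) (at level 40, left associativity).
Local Notation tr x := (dot x one).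

(** The properties of the Jordan algebra that everything below rests on.  The
    trace is the inner product with the unit. *)
Record cubic_algebra : Prop := CubicAlgebra {
  cmulC : forall x y, x ** y = y ** x;
  cmulDl : forall x y z, (x + y) ** z = x ** z + y ** z;
  cmulZl : forall (a : R) x y, (a *: x) ** y = a *: (x ** y);
  cmul1 : forall x, x ** one = x;
  cdotC : forall x y, dot x y = dot y x;
  cdotDl : forall x y z, dot (x + y) z = dot x z + dot y z;
  cdotZl : forall (a : R) x y, dot (a *: x) y = a * dot x y;
  cdot_gt0 : forall x, x != 0 -> 0 < dot x x;
  cdotA : forall x y z, dot (x ** y) z = dot x (y ** z);
  cubic_identity : forall x, x ** (x ** x)
    = tr x *: (x ** x) - ((tr x ^+ 2 - dot x x) / 2) *: x
      + (dot x (x ** x) / 3 - tr x * dot x x / 2 + tr x ^+ 3 / 6) *: one }.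

Context (alg : cubic_algebra).
Implicit Types (x y z w : V) (a : R).

Let mulC := cmulC alg.
Let mulDl := cmulDl alg.
Let mulZl := cmulZl alg.
Let mul1 := cmul1 alg.
Let dotC := cdotC alg.
Let dotDl := cdotDl alg.
Let dotZl := cdotZl alg.
Let dotA := cdotA alg.

Lemma cmulDr x y z : x ** (y + z) = x ** y + x ** z.
Proof. by rewrite !(mulC x) mulDl. Qed.

Lemma cmulZr a x y : x ** (a *: y) = a *: (x ** y).
Proof. by rewrite !(mulC x) mulZl. Qed.

Lemma cmulNl x y : (- x) ** y = - (x ** y).
Proof. by rewrite -scaleN1r mulZl scaleN1r. Qed.

Lemma cmulNr x y : x ** (- y) = - (x ** y).
Proof. by rewrite !(mulC x) cmulNl. Qed.

Lemma cdotDr x y z : dot x (y + z) = dot x y + dot x z.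
Proof. by rewrite !(dotC x) dotDl. Qed.

Lemma cdotZr a x y : dot x (a *: y) = a * dot x y.
Proof. by rewrite !(dotC x) dotZl. Qed.

Lemma cdotNl x y : dot (- x) y = - dot x y.
Proof. by rewrite -scaleN1r dotZl mulN1r. Qed.

Lemma cdotNr x y : dot x (- y) = - dot x y.
Proof. by rewrite !(dotC x) cdotNl. Qed.

Lemma cdot0l x : dot 0 x = 0.
Proof. by rewrite -(scale0r x) dotZl mul0r. Qed.

Lemma cmul0l x : 0 ** x = 0.
Proof. by rewrite -(scale0r x) mulZl !scale0r. Qed.

Lemma cdot_ge0 x : 0 <= dot x x.
Proof.
by have [->|/(cdot_gt0 alg)/ltW//] := eqVneq x 0; rewrite cdot0l.
Qed.

Lemma cdot_eq0 x : dot x x = 0 -> x = 0.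
Proof.
by move=> xx; apply/eqP; case: eqP => // /eqP /(cdot_gt0 alg); rewrite xx ltxx.
Qed.

Lemma cdot_ext x y : (forall z, dot x z = dot y z) -> x = y.
Proof.
move=> xy; apply/subr0_eq/cdot_eq0.
by rewrite dotDl cdotNl xy subrr.
Qed.

Let mul_lin := (mulDl, mulZl, cmulDr, cmulZr, cmulNl, cmulNr).
Let dot_lin := (dotDl, dotZl, cdotDr, cdotZr, cdotNl, cdotNr).

(** The part of the cubic equation that is quadratic in y and linear in z: half
    the sum of the equations at z + y and z - y, minus the equation at z. *)
Lemma polarized_identity y z :
  2 *: (y ** (y ** z)) + z ** (y ** y)
  = tr z *: (y ** y) + (2 * tr y) *: (y ** z)
    - ((tr y ^+ 2 - dot y y) / 2) *: z - (tr y * tr z - dot y z) *: y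
    + (dot z (y ** y) - dot y z * tr y - dot y y * tr z / 2
       + tr y ^+ 2 * tr z / 2) *: one.
Proof.
apply: cdot_ext => w.
have id v := congr1 (dot ^~ w) (cubic_identity alg v).
have := id (z + y); have := id (z - y); have := id z.
have yyz : dot y (y ** z) = dot z (y ** y) by rewrite -dotA dotC.
have zyz : dot z (y ** z) = dot y (z ** z) by rewrite (mulC y) -dotA dotC.
rewrite !(mul_lin, dot_lin) !(mulC z y) ?(dotC z y) ?yyz ?zyz.
lra.
Qed.

Lemma ctr_mul x y : tr (x ** y) = dot x y.
Proof. by rewrite dotA mul1. Qed.

Lemma traceless_cube y : tr y = 0 -> dot y (y ** y) = 0 ->
  y ** (y ** y) = (dot y y / 2) *: y.
Proof.
move=> try0 det0; rewrite (cubic_identity alg) try0 det0; apply: cdot_ext => w.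
by rewrite !dot_lin; field.
Qed.

Lemma traceless_sq_sq y : tr y = 0 -> dot y (y ** y) = 0 ->
  (y ** y) ** (y ** y) = (dot y y / 2) *: (y ** y).
Proof.
move=> try0 det0; have := polarized_identity y (y ** y).
rewrite traceless_cube // try0 det0 ctr_mul cmulZr.
rewrite (dotA y y) traceless_cube // cdotZr => id.
apply: cdot_ext => w; have := congr1 (dot ^~ w) id.
by rewrite !dot_lin; lra.
Qed.

(** ** The half space of a primitive idempotent *)
Section PeirceHalfSpace.
Context (x y : V).
Context (xx : x ** x = x) (trx : tr x = 1) (xy : x ** y = 2^-1 *: y).

Lemma peirce_dot0 : dot x y = 0.
Proof.
by have := dotA x x y; rewrite xx xy cdotZr; lra.
Qed.

Lemma peirce_tr0 : tr y = 0.
Proof.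
have := ctr_mul x y; rewrite xy dotZl peirce_dot0; lra.
Qed.

(** The polarized identity at (y, x): the two terms y^2 cancel. *)
Lemma peirce_sq : x ** (y ** y) = (dot y y / 2) *: x.
Proof.
have := polarized_identity y x.
rewrite (mulC y x) xy cmulZr trx peirce_tr0 (dotC y x) peirce_dot0.
rewrite -dotA xy dotZl scalerA mulfV ?pnatr_eq0 // scale1r => id.
apply: cdot_ext => w; have := congr1 (dot ^~ w) id.
by rewrite !dot_lin; lra.
Qed.

(** Pairing the cubic equation of y with x computes the determinant of y in two
    ways, as 1/2 and as 1/3 of dot y (y ** y). *)
Lemma peirce_det0 : dot y (y ** y) = 0.
Proof.
have := congr1 (dot x) (cubic_identity alg y).
rewrite -(dotA x) xy dotZl peirce_tr0 !dot_lin peirce_dot0 trx.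
rewrite -(dotA x) xy dotZl.
lra.
Qed.

(** The square of y lies in the sum of the Peirce spaces 0 and 1, which is
    orthogonal to the half space. *)
Lemma peirce_sq_dot w : x ** w = 2^-1 *: w -> dot (y ** y) w = 0.
Proof.
move=> xw; have := dotA (y ** y) x w.
rewrite (mulC _ x) peirce_sq xw dotZl cdotZr.
have := dotA x x w; rewrite xx xw cdotZr => xw0.
have -> : dot x w = 0 by lra.
by lra.
Qed.

End PeirceHalfSpace.

(** ** Pairs with u + i v of square zero *)
Section NullPair.
Context (u v : V).
Context (uuvv : u ** u = v ** v) (uv0 : u ** v = 0).

Lemma null_dot : dot u v = 0.
Proof. by rewrite -ctr_mul uv0 cdot0l. Qed.

Lemma null_norm : dot v v = dot u u.
Proof. by rewrite -(ctr_mul v v) -(ctr_mul u u) uuvv. Qed.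

Lemma null_detl : dot u (u ** u) = 0.
Proof. by rewrite uuvv -dotA uv0 cdot0l. Qed.

Lemma null_detr : dot v (v ** v) = 0.
Proof. by rewrite -uuvv -dotA mulC uv0 cdot0l. Qed.

(** The cubic equation for u + i v, paired with u and with v, says that the fourth
    power of the complex number tr u + i tr v vanishes. *)
Lemma null_tr : tr u = 0 /\ tr v = 0.
Proof.
have vu0 : v ** u = 0 by rewrite mulC.
have vu : dot v u = 0 by rewrite dotC null_dot.
have idu := polarized_identity v u; have idv := polarized_identity u v.
rewrite vu0 (mulC v 0) cmul0l -uuvv (cubic_identity alg u) null_detl in idu.
rewrite uv0 (mulC u 0) cmul0l uuvv (cubic_identity alg v) null_detr in idv.
rewrite null_norm vu in idu; rewrite null_norm null_dot in idv.
have := congr1 (dot u) idu; have := congr1 (dot v) idu.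
have := congr1 (dot u) idv; have := congr1 (dot v) idv.
rewrite !dot_lin !null_norm -!uuvv !null_detl !uuvv !null_detr null_dot vu.
rewrite !(dotC _ 0) !cdot0l; move: (tr u) (tr v) (dot u u) => s t m.
move=> e1 e2 e3 e4.
(* These are the real and imaginary parts of (s + i t) ^+ 4. *)
have re : s ^+ 4 - 6 * (s ^+ 2 * t ^+ 2) + t ^+ 4 = 0 by lra.
have im : s * t * (s ^+ 2 - t ^+ 2) = 0 by lra.
have /eqP : (s ^+ 2 + t ^+ 2) ^+ 4 = 0.
  transitivity ((s ^+ 4 - 6 * (s ^+ 2 * t ^+ 2) + t ^+ 4) ^+ 2
                + 16 * (s * t * (s ^+ 2 - t ^+ 2)) ^+ 2); first by ring.
  by rewrite re im !expr0n mulr0 addr0.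
rewrite expf_eq0 /= paddr_eq0 ?sqr_ge0 // !sqrf_eq0.
by case/andP => /eqP -> /eqP ->.
Qed.

(** ** The tangent vector recovered from a null pair *)

(** n is the squared length of the tangent vector y to be found.  Since v is
    sqrt (n / 2) y, the factor c is a square root of 2 / n; since u is n x - y^2,
    solving for x gives the formula below. *)
Section Preimage.
Context (n c : R).
Context (n_neq0 : n != 0) (ccn : c ^+ 2 = 2 / n).
Context (nn : dot u u = n ^+ 2 / 2).

Let y := c *: v.
Let x := n^-1 *: (u + y ** y).

Let yyE : y ** y = (2 / n) *: (v ** v).
Proof. by rewrite /y !mul_lin scalerA -expr2 ccn. Qed.

Let u_sq : u ** (v ** v) = (n ^+ 2 / 4) *: u.
Proof.
rewrite -uuvv traceless_cube ?null_detl //; last by case: null_tr.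
by rewrite nn; congr (_ *: _); field.
Qed.

Let v_sq : v ** (v ** v) = (n ^+ 2 / 4) *: v.
Proof.
rewrite traceless_cube ?null_detr //; last by case: null_tr.
by rewrite null_norm nn; congr (_ *: _); field.
Qed.

Let sq_sq : (v ** v) ** (v ** v) = (n ^+ 2 / 4) *: (v ** v).
Proof.
rewrite traceless_sq_sq ?null_detr //; last by case: null_tr.
by rewrite null_norm nn; congr (_ *: _); field.
Qed.

Lemma preimage_tr : tr x = 1.
Proof.
rewrite dotZl dotDl yyE dotZl ctr_mul null_norm nn (proj1 null_tr).
by field.
Qed.

Lemma preimage_idem : x ** x = x.
Proof.
rewrite /x yyE !mul_lin (mulC (v ** v) u) u_sq sq_sq uuvv.
by apply: cdot_ext => w; rewrite !dot_lin; field.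
Qed.

Lemma preimage_half : x ** y = 2^-1 *: y.
Proof.
rewrite /x yyE /y !mul_lin uv0 (mulC (v ** v) v) v_sq.
by apply: cdot_ext => w; rewrite !dot_lin cdot0l; field.
Qed.

Lemma preimage_norm : dot y y = n.
Proof. by rewrite !dot_lin mulrA -expr2 ccn null_norm nn; field. Qed.

End Preimage.

End NullPair.

(** ** The null pair of a tangent vector *)
Section ImageOfPeirce.
Context (x y : V) (n : R).
Context (xx : x ** x = x) (trx : tr x = 1) (xy : x ** y = 2^-1 *: y).
Context (yy : dot y y = n).

Let u := n *: x - y ** y.

Lemma image_sq : u ** u = (n / 2) *: (y ** y).
Proof.
rewrite /u !mul_lin xx (mulC (y ** y) x) peirce_sq // traceless_sq_sq;
  [|exact: (peirce_tr0 xx xy)|exact: (peirce_det0 xx trx xy)].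
by rewrite yy; apply: cdot_ext => w; rewrite !dot_lin; field.
Qed.

Lemma image_mul0 : u ** y = 0.
Proof.
rewrite /u !mul_lin xy (mulC (y ** y) y) traceless_cube;
  [|exact: (peirce_tr0 xx xy)|exact: (peirce_det0 xx trx xy)].
by rewrite yy; apply: cdot_ext => w; rewrite !dot_lin cdot0l; field.
Qed.

Lemma image_norm : dot u u = n ^+ 2 / 2.
Proof. by rewrite -ctr_mul image_sq dotZl ctr_mul yy; field. Qed.

End ImageOfPeirce.

Lemma complex_sq0 u v :
  u ** u - v ** v = 0 /\ u ** v + v ** u = 0 <-> u ** u = v ** v /\ u ** v = 0.
Proof.
rewrite (mulC v u) -mulr2n -scaler_nat; split=> [[/subr0_eq -> /eqP]|[-> ->]].
  by rewrite scaler_eq0 pnatr_eq0 => /eqP.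
by rewrite subrr scaler0.
Qed.

End CubicAlgebra.

(** * Hermitian octonion matrices form a cubic algebra *)
Section JordanCubic.
Context {R : realType}.
Implicit Types (X Y Z : jordan R) (A B : jordanC R).

Lemma odot_ge0 (x : 'rV[R]_8) : 0 <= odot x x.
Proof. by apply: sumr_ge0 => k _; rewrite -expr2 sqr_ge0. Qed.

Lemma odot_eq0 (x : 'rV[R]_8) : odot x x = 0 -> x = 0.
Proof.
move=> xx0; have sq_ge0 k : true -> 0 <= x 0 k * x 0 k.
  by rewrite -expr2 sqr_ge0.
apply/rowP => k; rewrite mxE; apply/eqP.
by have := psumr_eq0P sq_ge0 xx0 (i := k) isT => /eqP; rewrite mulf_eq0 orbb.
Qed.

Lemma jdot_gt0 X : X != 0 -> 0 < jdot X X.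
Proof.
elim/(@jor_ind R): X => p q r x y z; rewrite jor_dot => X0.
have := (odot_ge0 x, odot_ge0 y, odot_ge0 z).
move: (@odot_eq0 x) (@odot_eq0 y) (@odot_eq0 z).
move: (odot x x) (odot y y) (odot z z) => a b c ax bx cx [[a0 b0] c0].
have p0 := sqr_ge0 p; have q0 := sqr_ge0 q; have r0 := sqr_ge0 r.
rewrite lt_def; apply/andP; split; last by nra.
apply: contra X0 => /eqP s0.
have /eqP : p ^+ 2 = 0 by nra.
have /eqP : q ^+ 2 = 0 by nra.
have /eqP : r ^+ 2 = 0 by nra.
rewrite !sqrf_eq0 => /eqP -> /eqP -> /eqP ->.
have -> : x = 0 by apply: ax; nra.
have -> : y = 0 by apply: bx; nra.
have -> : z = 0 by apply: cx; nra.
apply/eqP; congr pair; first by apply/rowP; elim/ord3E; rewrite !mxE.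
by apply/matrixP => i k; elim/ord3E: i; rewrite !mxE /= ?mxE.
Qed.

Lemma jordan_cubic : @cubic_algebra R (jordan R : lmodType R) jmul jdot jone.
Proof.
split.
- exact: jmul_comm.
- exact: jmulDl.
- exact: jmulZl.
- exact: jmul1.
- exact: jdot_comm.
- move=> X Y Z; rewrite /jdot jmulDl /jtr -big_split.
  by apply: eq_bigr => i _; rewrite mxE.
- move=> a X Y; rewrite /jdot jmulZl /jtr mulr_sumr.
  by apply: eq_bigr => i _; rewrite mxE.
- exact: jdot_gt0.
- exact: jdotA.
- by move=> X; rewrite jdot1 cayley_hamilton.
Qed.

End JordanCubic.

(** * Cotangent vectors and the null cone *)
Section CotangentAndNullCone.
Context {R : rcfType} {V : lmodType R}.
Context (mul : V -> V -> V) (dot : V -> V -> R) (one : V).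
Context (alg : cubic_algebra mul dot one).
Local Notation "x ** y" := (mul x y) (at level 40, left associativity).
Implicit Types (p A : V * V) (x y w : V).

Let dot_ge0 := cdot_ge0 alg.
Let mul_lin := (cmulDl alg, cmulZl alg, cmulDr alg, cmulZr alg,
  cmulNl alg, cmulNr alg).
Let dot_lin := (cdotDl alg, cdotZl alg, cdotDr alg, cdotZr alg,
  cdotNl alg, cdotNr alg).

Definition cnorm x : R := Num.sqrt (dot x x).

Definition rdot A B : R := dot A.1 B.1 + dot A.2 B.2.

Definition pnorm A : R := Num.sqrt (rdot A A).

Definition in_cotangent p : Prop :=
  [/\ p.1 ** p.1 = p.1, dot p.1 one = 1, p.1 ** p.2 = 2^-1 *: p.2
    & p.2 != 0].

Definition in_cone A : Prop :=
  [/\ A.1 ** A.1 = A.2 ** A.2, A.1 ** A.2 = 0 & A != 0].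

Definition tau p : V * V :=
  (cnorm p.2 ^+ 2 *: p.1 - p.2 ** p.2, (cnorm p.2 / Num.sqrt 2) *: p.2).

Definition tau_inv A : V * V :=
  let y := (Num.sqrt 2 / Num.sqrt (pnorm A)) *: A.2 in
  ((pnorm A)^-1 *: (A.1 + y ** y), y).

Lemma cnorm_sq x : cnorm x ^+ 2 = dot x x.
Proof. by rewrite sqr_sqrtr // dot_ge0. Qed.

Lemma cnorm_gt0 x : x != 0 -> 0 < cnorm x.
Proof. by move=> /(cdot_gt0 alg); rewrite sqrtr_gt0. Qed.

Lemma rdot_ge0 A : 0 <= rdot A A.
Proof. by rewrite addr_ge0 ?dot_ge0. Qed.

Lemma rdot_gt0 A : A != 0 -> 0 < rdot A A.
Proof.
case: A => x y; rewrite /rdot /= => A0.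
have [x0|/(cdot_gt0 alg) xx] := eqVneq x 0; last by rewrite ltr_pwDl ?dot_ge0.
rewrite ltr_wpDl ?dot_ge0 ?(cdot_gt0 alg) //.
by apply: contra A0 => /eqP ->; rewrite x0.
Qed.

Lemma tau_rdot p : in_cotangent p -> rdot (tau p) (tau p) = dot p.2 p.2 ^+ 2.
Proof.
case: p => x y [/= xx trx xy _].
rewrite /rdot /tau /= cnorm_sq (image_norm alg xx trx xy erefl).
rewrite !dot_lin mulrA -expr2 expr_div_n cnorm_sq sqr_sqrtr //.
by move: (dot y y) => n; field.
Qed.

Lemma tau_norm p : in_cotangent p -> pnorm (tau p) = dot p.2 p.2.
Proof.
by move=> /tau_rdot tt; rewrite /pnorm tt sqrtr_sqr ger0_norm ?dot_ge0.
Qed.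

Lemma tau_in_cone p : in_cotangent p -> in_cone (tau p).
Proof.
move=> Mp; have := tau_rdot Mp.
case: p Mp => x y [/= xx trx xy y0] tt.
have S := image_sq alg xx trx xy erefl.
have P := image_mul0 alg xx trx xy erefl.
rewrite /in_cone /tau /= cnorm_sq; split.
- rewrite S !mul_lin scalerA -expr2 expr_div_n cnorm_sq sqr_sqrtr //.
- by rewrite (cmulZr alg) P scaler0.
- apply/eqP => t0; move: tt; rewrite /tau /= cnorm_sq t0 /rdot /=.
  rewrite (cdot0l alg) addr0 => /esym/eqP; rewrite sqrf_eq0 gt_eqF //.
  exact: (cdot_gt0 alg).
Qed.

Section FromCone.
Context (A : V * V).
Context (coneA : in_cone A).

Lemma pnorm_gt0 : 0 < pnorm A.
Proof. by case: coneA => _ _ /rdot_gt0; rewrite sqrtr_gt0. Qed.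

Lemma cone_dot : dot A.1 A.1 = pnorm A ^+ 2 / 2.
Proof.
case: coneA => uu uv _; rewrite sqr_sqrtr ?rdot_ge0 // /rdot.
rewrite (null_norm alg uu).
by move: (dot A.1 A.1) => n; field.
Qed.

Let n0 : pnorm A != 0. Proof. by rewrite gt_eqF ?pnorm_gt0. Qed.

Let cc : (Num.sqrt 2 / Num.sqrt (pnorm A)) ^+ 2 = 2 / pnorm A.
Proof. by rewrite expr_div_n !sqr_sqrtr // ltW ?pnorm_gt0. Qed.

Lemma tau_inv_norm : dot (tau_inv A).2 (tau_inv A).2 = pnorm A.
Proof.
by case: coneA => uu _ _; exact: (preimage_norm alg uu n0 cc cone_dot).
Qed.

Lemma tau_inv_cotangent : in_cotangent (tau_inv A).
Proof.
case: coneA => uu uv A0; split.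
- exact: (preimage_idem alg uu uv n0 cc cone_dot).
- exact: (preimage_tr alg uu uv n0 cc cone_dot).
- exact: (preimage_half alg uu uv n0 cc cone_dot).
- apply/eqP => y0; have := tau_inv_norm; rewrite y0 (cdot0l alg) => n00.
  by move: n0; rewrite -n00 eqxx.
Qed.

Lemma tau_invK : tau (tau_inv A) = A.
Proof.
rewrite /tau cnorm_sq /cnorm tau_inv_norm /=.
have sn0 : Num.sqrt (pnorm A) != 0 by rewrite gt_eqF // sqrtr_gt0 pnorm_gt0.
have s20 : Num.sqrt 2 != 0 :> R by rewrite gt_eqF ?sqrtr_gt0.
rewrite !scalerA mulfV // scale1r addrK.
have -> : Num.sqrt (pnorm A) / Num.sqrt 2
    * (Num.sqrt 2 / Num.sqrt (pnorm A)) = 1 by field; rewrite ?s20 ?sn0.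
by rewrite scale1r; case: (A).
Qed.

End FromCone.

Lemma tau_inj p q : in_cotangent p -> in_cotangent q -> tau p = tau q -> p = q.
Proof.
move=> Mp Mq; have := tau_norm Mp; have := tau_norm Mq.
case: p Mp => x y [/= _ _ _ y0]; case: q Mq => x' y' [/= _ _ _ y'0].
rewrite /tau /= => nq np tt; have n : cnorm y = cnorm y'.
  by rewrite /cnorm -nq -np tt.
have y_gt0 := cnorm_gt0 y0.
have c0 : cnorm y' / Num.sqrt 2 != 0.
  by rewrite -n mulf_neq0 ?invr_eq0 ?gt_eqF // sqrtr_gt0.
move: tt; rewrite n => -[] t1 /(scalerI c0) yy'; move: t1; rewrite yy'.
by move/addIr/scalerI => ->; rewrite // expf_neq0 // -n gt_eqF.
Qed.

End CotangentAndNullCone.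

(** * Differential calculus on the Jordan algebra *)
Section BilinearCalculus.
Context {R : realType}.

Lemma is_diff_derive (U W : normedModType R) (f df : U -> W) x v :
  is_diff x f df -> is_derive x v f (df v).
Proof.
move=> fx; have fdiff : differentiable f x by [].
apply: DeriveDef; first exact: diff_derivable.
by rewrite deriveE // diff_val.
Qed.

Lemma is_derive_diff (W : normedModType R) (f : R -> W) (t : R) (df : W) :
  is_derive t 1 f df -> is_diff t f ( *:%R^~ df).
Proof.
move=> ft; have fdiff : derivable f t 1 by apply: ex_derive.
apply: DiffDef; first exact/derivable1_diffP.
by rewrite deriv1E // derive1E derive_val.
Qed.

(** The coordinates and basis below give the continuity of arbitrary linear and
    bilinear maps by expansion into finite sums. *)
Definition jcoord (i : 'I_3 + 'I_3 * 'I_8) (X : jordan R) : R :=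
  match i with inl i => X.1 0 i | inr (i, k) => X.2 i k end.

Definition jbasis (i : 'I_3 + 'I_3 * 'I_8) : jordan R :=
  match i with
  | inl i => (delta_mx 0 i, 0) | inr (i, k) => (0, delta_mx i k)
  end.

Lemma jbasis_sum (X : jordan R) : X = \sum_i jcoord i X *: jbasis i.
Proof.
rewrite [RHS]surjective_pairing (raddf_sum fst) (raddf_sum snd) !big_sumType.
case: X => x y; congr pair; rewrite /=.
- rewrite [X in _ + X]big1 => [|[i k] _ /=]; last by rewrite scaler0.
  by rewrite addr0 {1}[x]row_sum_delta.
- rewrite [X in X + _]big1 => [|i _ /=]; last by rewrite scaler0.
  rewrite add0r {1}[y]matrix_sum_delta pair_bigA.
  by apply: eq_bigr => -[i k].
Qed.

Lemma jcoord_continuous i : continuous (jcoord i).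
Proof.
case: i => [i|[i k]] X.
- apply: (@continuous_comp _ _ _ fst (fun M : 'rV[R]_3 => M 0 i)).
    exact: cvg_fst.
  exact: coord_continuous.
- apply: (@continuous_comp _ _ _ snd (fun M : 'M[R]_(3, 8) => M i k)).
    exact: cvg_snd.
  exact: coord_continuous.
Qed.

Context (W : normedModType R).

Lemma jordan_linear_continuous (L : {linear jordan R -> W}) : continuous L.
Proof.
have -> : (L : jordan R -> W) = fun X => \sum_i jcoord i X *: L (jbasis i).
  apply/funext => X; rewrite {1}[X]jbasis_sum linear_sum.
  by apply: eq_bigr => i _; rewrite linearZ.
apply: continuous_big => [|i _ X]; first exact: add_continuous.
by apply: cvgZr_tmp; exact: jcoord_continuous.
Qed.

Lemma jordan_bilinear_continuous (B : {bilinear jordan R -> jordan R -> W}) :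
  continuous (fun p : jordan R * jordan R => B p.1 p.2).
Proof.
have -> : (fun p : jordan R * jordan R => B p.1 p.2)
    = fun p => \sum_i jcoord i p.1 *: B (jbasis i) p.2.
  apply/funext => p; rewrite {1}[p.1]jbasis_sum linear_sumlz.
  by apply: eq_bigr => i _; rewrite linearZl_LR.
apply: continuous_big => [|i _ p]; first exact: add_continuous.
apply: cvgZ.
  apply: (@continuous_comp _ _ _ fst (jcoord i)); first exact: cvg_fst.
  exact: jcoord_continuous.
apply: (@continuous_comp _ _ _ snd (B (jbasis i))); first exact: cvg_snd.
exact: (@jordan_linear_continuous (B (jbasis i))).
Qed.

Lemma jordan_bilinear_diff (B : {bilinear jordan R -> jordan R -> W}) p :
  is_diff p (fun q => B q.1 q.2) (fun q => B p.1 q.2 + B q.1 p.2).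
Proof.
apply: DiffDef; first exact/differentiable_bilin/jordan_bilinear_continuous.
exact/diff_bilin/jordan_bilinear_continuous.
Qed.

End BilinearCalculus.

Section PointwiseDifferentials.
Context {R : realType} {U : normedModType R}.
Implicit Types (f g df dg : U -> R) (x : U).

Lemma is_diff_mul f g df dg x : is_diff x f df -> is_diff x g dg ->
  is_diff x (fun y => f y * g y) (fun h => f x * dg h + df h * g x).
Proof.
move=> fx gx; apply: is_diff_eq; apply/funext => h /=.
by rewrite [df h * _]mulrC.
Qed.

Lemma is_diff_scale (c : R) f df x : is_diff x f df ->
  is_diff x (fun y => c * f y) (fun h => c * df h).
Proof. by move=> fx; exact: is_diffZ. Qed.

Lemma is_diff_sub f g df dg x : is_diff x f df -> is_diff x g dg ->
  is_diff x (fun y => f y - g y) (fun h => df h - dg h).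
Proof. by move=> fx gx; exact: is_diffB. Qed.

Lemma is_diff_real (phi : R -> R) f df x d : is_derive (f x) 1 phi d ->
  is_diff x f df -> is_diff x (fun y => phi (f y)) (fun h => df h * d).
Proof. by move=> /is_derive_diff phix fx; exact: is_diff_comp. Qed.

Lemma is_diff_sqrt f df x : 0 < f x -> is_diff x f df ->
  is_diff x (fun y => Num.sqrt (f y)) (fun h => df h / (2 * Num.sqrt (f x))).
Proof. by move=> fx0; apply/is_diff_real/is_derive1_sqrt. Qed.

Lemma is_diff_expV n f df x : f x != 0 -> is_diff x f df ->
  is_diff x (fun y => (f y ^+ n.+1)^-1)
            (fun h => - (n.+1%:R * df h / f x ^+ n.+2)).
Proof.
move=> fx0 fx; have fn : is_diff x (fun y => f y ^+ n.+1)
    (fun h => n.+1%:R * f x ^+ n * df h).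
  have -> : (fun y => f y ^+ n.+1) = f ^+ n.+1 by rewrite exprfctE.
  by apply: is_diff_eq.
have fn0 : f x ^+ n.+1 != 0 by rewrite expf_neq0.
have fnd : differentiable (fun y => f y ^+ n.+1) x by [].
apply: DiffDef; first exact: differentiableV.
rewrite (diffV fnd fn0) diff_val; apply/funext => h /=.
by rewrite /GRing.scale /= !exprS; field; rewrite ?fx0 ?expf_neq0.
Qed.

(** Differentiability depends only on the germ: the forms below are given by
    formulas valid away from the origin. *)
Lemma is_diff_near (W : normedModType R) (f g df : U -> W) x :
  (\forall y \near x, f y = g y) -> is_diff x f df -> is_diff x g df.
Proof.
move=> fg fx; have /diff_locallyP[dfc /eqaddoP fo] : differentiable f x by [].
have gE : g \o shift x = cst (g x) + 'd f x +o_ 0 id.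
  have gf : \forall h \near 0, (g \o shift x) h = (f \o shift x) h.
    have := fg; rewrite (near_shift 0).
    by apply: filterS => h /=; rewrite subr0.
  apply/eqaddoP => e e0; have := fo e e0.
  apply: filterS2 gf => h gh; rewrite -(nbhs_singleton fg).
  by move: gh; rewrite !fctE /= => ->.
apply: DiffDef; first by apply/diff_locallyP; rewrite (diff_unique dfc gE).
by rewrite (diff_unique dfc gE) diff_val.
Qed.

End PointwiseDifferentials.

Section BilinearJordan.
Context {R : realType}.

Lemma bilinear_is_diff (W : normedModType R) (B : jordan R -> jordan R -> W) p :
  (forall y, linear (B ^~ y)) -> (forall x, linear (B x)) ->
  is_diff p (fun q => B q.1 q.2) (fun q => B p.1 q.2 + B q.1 p.2).
Proof.
move=> Bl Br.
have Bbil : bilinear_for (GRing.Scale.Law.clone _ _ *:%R _)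
    (GRing.Scale.Law.clone _ _ *:%R _) B by [].
pose BM := bilinear_isBilinear.Build R (jordan R) (jordan R) W _ _ B Bbil.
pose BB : {bilinear jordan R -> jordan R -> W} := HB.pack B BM.
exact: (@jordan_bilinear_diff R W BB).
Qed.

Lemma is_diff_fst (U V : normedModType R) (p : U * V) : is_diff p fst fst.
Proof.
have c : continuous (@fst U V) by move=> q; exact: cvg_fst.
apply: DiffDef; first exact: (@linear_differentiable _ _ _ fst).
exact: (@diff_lin _ _ _ fst).
Qed.

Lemma is_diff_snd (U V : normedModType R) (p : U * V) : is_diff p snd snd.
Proof.
have c : continuous (@snd U V) by move=> q; exact: cvg_snd.
apply: DiffDef; first exact: (@linear_differentiable _ _ _ snd).
exact: (@diff_lin _ _ _ snd).
Qed.

End BilinearJordan.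

(** * The form with potential the square root of the norm *)
Section RealInnerProduct.
Context {R : realType} (mul : jordan R -> jordan R -> jordan R).
Context (dot : jordan R -> jordan R -> R) (one : jordan R).
Context (alg : cubic_algebra mul dot one).
Implicit Types (A u v w : jordanC R).
Local Open Scope complex_scope.

Local Notation rd := (rdot dot).
Local Notation J := (@Defs.cscale R 'i%C).

Lemma cscale_i u : J u = (- u.2, u.1).
Proof. by rewrite /Defs.cscale /= !scale0r !scale1r sub0r add0r. Qed.

Lemma rdotC u v : rd u v = rd v u.
Proof. by rewrite /rdot !(cdotC alg u.1) !(cdotC alg u.2). Qed.

Lemma rdotDl u v w : rd (u + v) w = rd u w + rd v w.
Proof. by rewrite /rdot !(cdotDl alg) addrACA. Qed.

Lemma rdotZl (a : R) u v : rd (a *: u) v = a * rd u v.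
Proof. by rewrite /rdot !(cdotZl alg) mulrDr. Qed.

Lemma rdotDr u v w : rd w (u + v) = rd w u + rd w v.
Proof. by rewrite !(rdotC w) rdotDl. Qed.

Lemma rdotZr (a : R) u v : rd v (a *: u) = a * rd v u.
Proof. by rewrite !(rdotC v) rdotZl. Qed.

Lemma rdotNr u v : rd v (- u) = - rd v u.
Proof. by rewrite -scaleN1r rdotZr mulN1r. Qed.

Lemma rdotNl u v : rd (- u) v = - rd u v.
Proof. by rewrite rdotC rdotNr rdotC. Qed.

Lemma rdot_i u v : rd u (J v) = - rd v (J u).
Proof.
rewrite !cscale_i /rdot /= !(cdotNr alg) (cdotC alg v.1) (cdotC alg v.2).
by rewrite opprD opprK addrC.
Qed.

Lemma cscale_ii u : J (J u) = - u.
Proof. by rewrite !cscale_i; case: u. Qed.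

Lemma rdot_iself u : rd u (J u) = 0.
Proof. by have := rdot_i u u; lra. Qed.

Lemma rdot_is_diff p :
  is_diff p (fun q : jordanC R * jordanC R => rd q.1 q.2)
    (fun q => rd p.1 q.2 + rd q.1 p.2).
Proof.
have dl y : linear (dot ^~ y : _ -> R).
  by move=> a u v; rewrite (cdotDl alg) (cdotZl alg).
have dr x : linear (dot x : _ -> R).
  by move=> a u v; rewrite (cdotDr alg) (cdotZr alg).
have d q := @bilinear_is_diff R R dot q dl dr.
have f1 : is_diff p (fun q : jordanC R * jordanC R => (q.1.1, q.2.1))
    (fun q => (q.1.1, q.2.1)).
  apply: is_diff_pair.
    exact: is_diff_comp (is_diff_fst p) (is_diff_fst _).
  exact: is_diff_comp (is_diff_snd p) (is_diff_fst _).
have f2 : is_diff p (fun q : jordanC R * jordanC R => (q.1.2, q.2.2))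
    (fun q => (q.1.2, q.2.2)).
  apply: is_diff_pair.
    exact: is_diff_comp (is_diff_fst p) (is_diff_snd _).
  exact: is_diff_comp (is_diff_snd p) (is_diff_snd _).
apply: is_diff_eq (is_diffD (is_diff_comp f1 (d _)) (is_diff_comp f2 (d _))) _.
by apply/funext => q; rewrite /rdot !fctE /= addrACA.
Qed.

Lemma rdotl_is_diff A v : is_diff A (rd ^~ v) (rd ^~ v).
Proof.
have f : is_diff A (fun B : jordanC R => (B, v)) (fun h => (h, 0)).
  exact: is_diff_pair.
apply: is_diff_eq (is_diff_comp f (rdot_is_diff _)) _.
by apply/funext => h /=; rewrite /= -(scale0r h) rdotZr mul0r add0r.
Qed.

Lemma rdot_sq_is_diff A : is_diff A (fun B => rd B B) (fun h => 2 * rd A h).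
Proof.
have f : is_diff A (fun B : jordanC R => (B, B)) (fun h => (h, h)).
  exact: is_diff_pair.
apply: is_diff_eq (is_diff_comp f (rdot_is_diff _)) _.
by apply/funext => h /=; rewrite /= (rdotC h) mulr_natl mulr2n.
Qed.

Definition snorm A : R := Num.sqrt (pnorm dot A).

Lemma snorm_gt0 A : A != 0 -> 0 < snorm A.
Proof. by move=> A0; rewrite !sqrtr_gt0; exact: (rdot_gt0 alg). Qed.

Lemma snorm4 A : snorm A ^+ 4 = rd A A.
Proof.
by rewrite (exprM _ 2 2) !sqr_sqrtr ?sqrtr_ge0 //; exact: (rdot_ge0 alg).
Qed.

Lemma snorm_is_diff A : A != 0 ->
  is_diff A snorm (fun h => rd A h / (2 * snorm A ^+ 3)).
Proof.
move=> A0; have s0 := snorm_gt0 A0; have N0 := rdot_gt0 alg A0.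
have p0 : 0 < pnorm dot A by rewrite sqrtr_gt0.
have p2 : pnorm dot A = snorm A ^+ 2 by rewrite sqr_sqrtr // ltW.
have d1 := @is_diff_sqrt R _ (fun B => rd B B) _ A N0 (rdot_sq_is_diff A).
have d := @is_diff_sqrt R _ (pnorm dot) _ A p0 d1.
apply: is_diff_eq d _; apply/funext => h.
rewrite -/(pnorm dot A) -/(snorm A) p2.
by field; rewrite gt_eqF.
Qed.

Lemma near_neq0 A : A != 0 -> \forall B \near A, B != 0.
Proof.
move=> A0; have o : open (~` [set (0 : jordanC R)]).
  exact/closed_openC/accessible_closed_set1/hausdorff_accessible/norm_hausdorff.
have : nbhs A (~` [set (0 : jordanC R)]).
  by apply: open_nbhs_nbhs; split => //; exact/eqP.
by apply: filterS => B /eqP.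
Qed.

(** The derivative in the direction u of the real part <B, w> / (4 s^3) of
    del snorm at w; the imaginary part is minus the same function at J w. *)
Definition kahler A u w : R :=
  rd u w / (4 * snorm A ^+ 3)
  - 3 * (rd A u * rd A w) / (8 * snorm A ^+ 7).

Lemma kahler_is_diff A w : A != 0 ->
  is_diff A (fun B => rd B w / (4 * snorm B ^+ 3)) (fun u => kahler A u w).
Proof.
move=> A0; have s0 : snorm A != 0 by rewrite gt_eqF ?snorm_gt0.
have -> : (fun B => rd B w / (4 * snorm B ^+ 3))
    = fun B => 4^-1 * (rd B w * (snorm B ^+ 3)^-1).
  by apply/funext => B; rewrite invfM mulrCA.
apply: is_diff_eq (is_diff_scale _ (is_diff_mul (rdotl_is_diff A w)
  (is_diff_expV 2 s0 (snorm_is_diff A0)))) _.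
by apply/funext => u; rewrite /kahler; field.
Qed.

Definition omegaR A u v : R :=
  Num.sqrt 2 * (kahler A u (J v) - kahler A v (J u)).

Lemma near_eq_ext_d0 (F G : jordanC R -> R[i]) A u :
  (\forall B \near A, F B = G B) -> ext_d0 F A u = ext_d0 G A u.
Proof.
move=> FG; congr (_ +i* _); apply: near_eq_derive;
  by apply: filterS FG => B ->.
Qed.

Lemma ext_d0_diff (f g df dg : jordanC R -> R) A u :
  is_diff A f df -> is_diff A g dg ->
  ext_d0 (fun B => f B +i* g B) A u = df u +i* dg u.
Proof.
move=> /is_diff_derive - /(_ u) fA /is_diff_derive - /(_ u) gA.
by rewrite /ext_d0 /= !derive_val.
Qed.

Lemma complex_half (x y : R) : (x +i* y) / 2 = (x / 2) +i* (y / 2) :> R[i].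
Proof.
apply: (@mulIf _ (2 : R[i])); first by rewrite pnatr_eq0.
rewrite divfK ?pnatr_eq0 // mulr_natr mulr2n; apply/eqP.
by rewrite eq_complex /= -!splitr !eqxx.
Qed.

Lemma real_sub_i_mul (a b : R) :
  (a +i* 0) - 'i%R * (b +i* 0) = a +i* (- b) :> R[i].
Proof.
rewrite -complexiE; apply/eqP; rewrite eq_complex /=.
by apply/andP; split; apply/eqP; ring.
Qed.

Lemma del_snorm A u : A != 0 ->
  del (fun B => (snorm B)%:C) A u
  = (rd A u / (4 * snorm A ^+ 3)) +i* (- (rd A (J u) / (4 * snorm A ^+ 3))).
Proof.
move=> A0; rewrite /del /part10.
have s0 : snorm A != 0 by rewrite gt_eqF ?snorm_gt0.
rewrite !(ext_d0_diff _ (snorm_is_diff A0) (is_diff_cst 0 A)).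
rewrite real_sub_i_mul complex_half; apply/eqP; rewrite eq_complex /=.
by apply/andP; split; apply/eqP; field.
Qed.

Lemma ext_d1_del_snorm A u v : A != 0 ->
  ext_d1 (del (fun B => (snorm B)%:C)) A u v
  = 0 +i* (- (kahler A u (J v) - kahler A v (J u))).
Proof.
move=> A0; rewrite /ext_d1.
have E w h : ext_d0 (del (fun B => (snorm B)%:C) ^~ w) A h
    = kahler A h w +i* (- kahler A h (J w)).
  rewrite (near_eq_ext_d0 (G := fun B =>
    (rd B w / (4 * snorm B ^+ 3)) +i* (- (rd B (J w) / (4 * snorm B ^+ 3))))).
    apply: (@ext_d0_diff _ _ (fun u => kahler A u w)
      (fun u => - kahler A u (J w))).
      exact: kahler_is_diff.
    exact: is_diffN (kahler_is_diff _ A0).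
  by apply: filterS (near_neq0 A0) => B B0; exact: del_snorm.
apply: etrans (congr2 (fun a b => a - b) (E v u) (E u v)) _.
apply/eqP; rewrite eq_complex /=.
rewrite {1 2}/kahler (rdotC u v) (mulrC (rd A u)) subrr eqxx /=.
apply/eqP; ring.
Qed.

Lemma kahler_J A u v :
  kahler A (J u) (J (J v)) - kahler A (J v) (J (J u))
  = kahler A u (J v) - kahler A v (J u).
Proof.
rewrite /kahler !cscale_ii !rdotNr (rdotC (J u)) (rdotC (J v)).
ring.
Qed.

(** The exterior derivative of del snorm is already invariant under i (kahler_J),
    so taking its (1,1) part changes nothing. *)
Lemma omega_snorm A u v : A != 0 ->
  (Num.sqrt 2)%:C * 'i * delbar10 (del (fun B => (snorm B)%:C)) A u v
  = (omegaR A u v)%:C.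
Proof.
move=> A0; rewrite /delbar10 /part11 !ext_d1_del_snorm // kahler_J.
rewrite [X in X / 2](_ : _ =
    0 +i* (- (2 * (kahler A u (J v) - kahler A v (J u))))); last first.
  apply/eqP; rewrite eq_complex /=.
  by apply/andP; split; apply/eqP; ring.
rewrite complex_half.
rewrite -complexiE /omegaR; apply/eqP; rewrite eq_complex /=.
by apply/andP; split; apply/eqP; field.
Qed.

End RealInnerProduct.

(** * Closedness, nondegeneracy and the rotation flow *)
Section ConeForm.
Context {R : realType} (mul : jordan R -> jordan R -> jordan R).
Context (dot : jordan R -> jordan R -> R) (one : jordan R).
Context (alg : cubic_algebra mul dot one).
Implicit Types (A u v w : jordanC R).
Local Open Scope complex_scope.

Local Notation rd := (rdot dot).
Local Notation J := (@Defs.cscale R 'i%C).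
Local Notation sn := (snorm dot).
Local Notation kh := (kahler dot).
Local Notation om := (omegaR dot).

Definition form_of_snorm : @form2 R := fun A u v =>
  (Num.sqrt 2)%:C * 'i%R * delbar10 (del (fun B => (sn B)%:C)) A u v.

Let rdC := rdotC alg.
Let rd_lin := (rdotDl alg, rdotZl alg, rdotDr alg, rdotZr alg,
  rdotNl alg, rdotNr alg).

Lemma form_of_snormE A u v : A != 0 -> form_of_snorm A u v = (om A u v)%:C.
Proof. by move=> A0; exact: (omega_snorm alg u v A0). Qed.

Lemma cscale_iD u v : J (u + v) = J u + J v.
Proof. by rewrite !cscale_i; congr pair; rewrite ?opprD. Qed.

Lemma cscale_iZ (a : R) u : J (a *: u) = a *: J u.
Proof. by rewrite !cscale_i; congr pair; rewrite scalerN. Qed.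

Lemma kahlerDl A (a : R) u v w :
  kh A (a *: u + v) w = a * kh A u w + kh A v w.
Proof. by rewrite /kahler !rd_lin; ring. Qed.

Lemma kahlerC A u v : kh A u v = kh A v u.
Proof. by rewrite /kahler (rdC u) (mulrC (rd A u)). Qed.

Lemma omegaRDl A (a : R) u v w :
  om A (a *: u + v) w = a * om A u w + om A v w.
Proof.
rewrite /omegaR cscale_iD cscale_iZ !(kahlerC A w) !kahlerDl; ring.
Qed.

(** The derivative in the direction u of the coefficient kahler A v w. *)
Definition dkahler A u v w : R :=
  - (3 * (rd v w * rd A u) / (8 * sn A ^+ 7))
  - 3 * (rd u v * rd A w + rd A v * rd u w) / (8 * sn A ^+ 7)
  + 21 * (rd A u * rd A v * rd A w) / (16 * sn A ^+ 11).

Lemma dkahler_is_diff A v w : A != 0 ->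
  is_diff A (fun B => kh B v w) (fun u => dkahler A u v w).
Proof.
move=> A0; have s0 : sn A != 0 by rewrite gt_eqF ?(snorm_gt0 alg).
have sd := snorm_is_diff alg A0.
have -> : (fun B => kh B v w) = fun B =>
    rd v w / 4 * (sn B ^+ 3)^-1
    - 3 / 8 * (rd B v * rd B w * (sn B ^+ 7)^-1).
  by apply/funext => B; rewrite /kahler !invfM; ring.
apply: is_diff_eq (is_diff_sub (is_diff_scale _ (is_diff_expV 2 s0 sd))
  (is_diff_scale _ (is_diff_mul (is_diff_mul (rdotl_is_diff alg A v)
    (rdotl_is_diff alg A w)) (is_diff_expV 6 s0 sd)))) _.
by apply/funext => u; rewrite /dkahler; field.
Qed.

Definition domegaR A u v w : R :=
  Num.sqrt 2 * (dkahler A u v (J w) - dkahler A u w (J v)).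

Lemma omegaR_is_diff A v w : A != 0 ->
  is_diff A (fun B => om B v w) (fun u => domegaR A u v w).
Proof.
move=> A0; apply: is_diff_scale.
by apply: is_diff_sub; exact: dkahler_is_diff.
Qed.

(** Once skew-adjointness has moved every i to the same side, the terms of the
    cyclic sum cancel. *)
Lemma domegaR_cycle A u v w :
  domegaR A u v w - domegaR A v u w + domegaR A w u v = 0.
Proof.
rewrite /domegaR /dkahler !(rdot_i alg v u) !(rdot_i alg w u) !(rdot_i alg w v).
rewrite (rdC v u) (rdC w u) (rdC w v).
move: (rd u v) (rd u w) (rd v w) => *; ring.
Qed.

Lemma rdot_JJ u v : rd (J u) (J v) = rd u v.
Proof. by rewrite (rdot_i alg) cscale_ii !rd_lin opprK. Qed.

(** The squared norm of |u|^2 A - <A, u> u - <A, J u> J u is nonnegative; u and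
    J u are orthogonal of equal length. *)
Lemma hermitian_bessel A u :
  rd u u * (rd A u ^+ 2 + rd A (J u) ^+ 2) <= rd u u ^+ 2 * rd A A.
Proof.
have := rdot_ge0 alg (rd u u *: A - rd A u *: u - rd A (J u) *: J u).
rewrite !rd_lin (rdC u A) (rdC (J u) A) (rdC (J u) u) (rdot_iself alg) rdot_JJ.
move: (rd u u) (rd A A) (rd A u) (rd A (J u)) => m N p q.
by lra.
Qed.

(** omega(u, J u) = 0 reads 4 |A|^2 |u|^2 = 3 (<A, u>^2 + <A, J u>^2), against the
    bound of hermitian_bessel. *)
Lemma omegaR_nondegenerate A u : A != 0 -> om A u (J u) = 0 -> u = 0.
Proof.
move=> A0; have N0 := rdot_gt0 alg A0; have s0 := snorm_gt0 alg A0.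
have b := hermitian_bessel A u.
rewrite /omegaR /kahler cscale_ii !rd_lin rdot_JJ => /eqP.
rewrite mulf_eq0 gt_eqF ?sqrtr_gt0 //= => /eqP e.
have e' : 4 * rd A A * rd u u = 3 * (rd A u ^+ 2 + rd A (J u) ^+ 2).
  rewrite -(snorm4 alg); move: e; set s := sn A in s0 *.
  move: (rd u u) (rd A u) (rd A (J u)) => m p q.
  set e := (X in X = 0).
  have -> : e = - ((4 * s ^+ 4 * m - 3 * (p ^+ 2 + q ^+ 2)) / (8 * s ^+ 7)).
    by rewrite /e; field; rewrite gt_eqF.
  move/eqP; rewrite oppr_eq0 mulf_eq0 invr_eq0 mulf_eq0 expf_eq0 pnatr_eq0 /=.
  by rewrite (gt_eqF s0) orbF subr_eq0 => /eqP.
apply/eqP; case: eqVneq => // /(rdot_gt0 alg) u0.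
move: b e' u0 N0.
move: (rd u u) (rd A A) (rd A u ^+ 2 + _) => m N P b e' u0 N0.
have : 0 < m ^+ 2 * N by rewrite mulr_gt0 // exprn_gt0.
have : 3 * (m * P) = 4 * (m ^+ 2 * N) by rewrite mulrCA -e'; ring.
by lra.
Qed.

Lemma form_of_snorm_symplectic : symplectic_form (@jordanC0 R) form_of_snorm.
Proof.
move=> A A0.
have nearE v w : \forall B \near A, form_of_snorm B v w = (om B v w)%:C.
  by apply: filterS (near_neq0 A0) => B B0; exact: form_of_snormE.
have dE u v w :
    ext_d0 (fun B => form_of_snorm B v w) A u = (domegaR A u v w)%:C.
  rewrite (near_eq_ext_d0 _ (nearE v w)).
  exact: (ext_d0_diff _ (omegaR_is_diff v w A0) (is_diff_cst 0 A)).
split.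
- by move=> u v; rewrite form_of_snormE.
- split=> [u|a u u' v]; rewrite !form_of_snormE // ?omegaRDl.
    by rewrite /omegaR subrr mulr0.
  by rewrite rmorphD rmorphM.
- move=> u v; have : is_diff A (fun B => complex.Re (form_of_snorm B u v))
      (fun u' => domegaR A u' u v).
    apply: is_diff_near (omegaR_is_diff u v A0).
    by apply: filterS (nearE u v) => B ->.
  by case.
- move=> u v w; have cycle (a b c a' b' c' : R[i]) :
    a = a' -> b = b' -> c = c' -> a - b + c = a' - b' + c' by do 3! move=> ->.
  apply: etrans (cycle _ _ _ _ _ _ (dE u v w) (dE v u w) (dE w u v)) _.
  by rewrite -rmorphB -rmorphD /= domegaR_cycle.
- move=> u /(_ (J u)); rewrite form_of_snormE //.
  move=> /(congr1 (@complex.Re R)) /=.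
  exact: omegaR_nondegenerate.
Qed.

Lemma phiCE t A : phiC t A = cos (- 2 * t) *: A + sin (- 2 * t) *: J A.
Proof.
by rewrite cscale_i /phiC /Defs.cscale /=; congr pair; rewrite /= ?scalerN.
Qed.

Lemma phiC0 A : phiC 0 A = A.
Proof. by rewrite phiCE mulr0 cos0 sin0 scale1r scale0r addr0. Qed.

Lemma phiCD (s t : R) A : phiC (s + t) A = phiC s (phiC t A).
Proof.
rewrite !phiCE mulrDr cosD sinD cscale_iD !cscale_iZ cscale_ii.
rewrite !scalerDr !scalerA scalerN.
rewrite scalerBl scalerDl -!addrA; congr (_ + _).
by rewrite [RHS]addrC -!addrA [RHS]addrCA.
Qed.

Lemma rdot_phiC t A : rd (phiC t A) (phiC t A) = rd A A.
Proof.
rewrite phiCE !rd_lin (rdC (J A) A) (rdot_iself alg) rdot_JJ !mulr0 addr0 add0r.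
by rewrite !mulrA -!expr2 -mulrDl cos2Dsin2 mul1r.
Qed.

Lemma is_derive_rotation (t : R) :
  is_derive t 1 (fun s : R => cos (- 2 * s)) (2 * sin (- 2 * t)) /\
  is_derive t 1 (fun s : R => sin (- 2 * s)) (- 2 * cos (- 2 * t)).
Proof.
have l : is_derive t 1 (fun s : R => - 2 * s) (- 2).
  have h : is_derive t 1 ((- 2 : R) \*: @id R) ((- 2 : R) *: (1 : R)).
    exact: is_deriveZ.
  by apply: is_derive_eq h _; exact: mulr1.
split.
- apply: is_derive_eq (is_derive1_comp (is_derive_cos _) l) _.
  by rewrite mulrNN mulrC.
- apply: is_derive_eq (is_derive1_comp (is_derive_sin _) l) _.
  by rewrite mulrC.
Qed.

Lemma is_derive_combination (W : normedModType R) (f g : R -> R) (a b : R)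
    (c x y : W) (t : R) :
  is_derive t 1 f a -> is_derive t 1 g b ->
  is_derive t 1 (fun s => c + (f s *: x + g s *: y)) (a *: x + b *: y).
Proof.
move=> fa gb.
have sc (h : R -> R) (d : R) (z : W) : is_derive t 1 h d ->
    is_derive t 1 (fun s => h s *: z) (d *: z).
  move=> hd; have := is_diff_comp (is_derive_diff hd) (is_diff_scalel (h t) z).
  by move=> /is_diff_derive - /(_ 1) /=; rewrite scale1r.
have := is_deriveD (is_derive_cst c t 1)
  (is_deriveD (sc _ _ x fa) (sc _ _ y gb)).
by rewrite add0r.
Qed.

Definition phiC_field A : jordanC R := (- 2) *: J A.

Lemma phiC_is_derive (t : R) A :
  is_derive t 1 (fun s => phiC s A) (phiC_field (phiC t A)).
Proof.
have [dc ds] := is_derive_rotation t.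
have -> : (fun s => phiC s A) = fun s =>
    0 + (cos (- 2 * s) *: A + sin (- 2 * s) *: J A).
  by apply/funext => s; rewrite phiCE add0r.
apply: is_derive_eq (is_derive_combination 0 A (J A) dc ds) _.
rewrite /phiC_field phiCE cscale_iD !cscale_iZ cscale_ii.
rewrite !scalerDr !scalerN !scalerA [RHS]addrC.
by rewrite -scaleNr -mulNr opprK.
Qed.

Lemma omegaR_phiC_field A w : A != 0 ->
  om A (phiC_field A) w = - (rd A w / (2 * sn A ^+ 3) / Num.sqrt 2).
Proof.
move=> A0; have s0 := snorm_gt0 alg A0.
rewrite /omegaR /kahler /phiC_field cscale_iZ cscale_ii !rd_lin rdot_JJ.
rewrite (rdot_iself alg) (rdC w) -(snorm4 alg).
have s2 : Num.sqrt 2 ^+ 2 = 2 :> R by rewrite sqr_sqrtr.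
have s20 : Num.sqrt 2 != 0 :> R by rewrite gt_eqF ?sqrtr_gt0.
have -> : (Num.sqrt 2)^-1 = Num.sqrt 2 / 2 :> R.
  by apply: (mulfI s20); rewrite mulfV // mulrA -expr2 s2 divff.
by move: (rd A w) => m; field; rewrite gt_eqF.
Qed.

(** Hamilton's equation holds against all vectors of the ambient space, so only
    the tangency of the field to M has to be seen, and the flow lines show it. *)
Lemma phiC_hamiltonian (M : set (jordanC R)) :
  M `<=` (@jordanC0 R) -> (forall t A, M A -> M (phiC t A)) ->
  hamiltonian_flow M form_of_snorm (fun A => sn A / Num.sqrt 2) phiC.
Proof.
move=> M0 Mphi; exists phiC_field => A MA; last first.
  split=> [|t|s t|t]; [exact: phiC0|exact: Mphi|exact: phiCD|].
  exact: phiC_is_derive.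
have A0 := M0 _ MA.
have d : is_diff A (fun A => sn A / Num.sqrt 2)
    (fun h => rd A h / (2 * sn A ^+ 3) / Num.sqrt 2).
  have -> : (fun A => sn A / Num.sqrt 2) = fun A => (Num.sqrt 2)^-1 * sn A.
    by apply/funext => B; rewrite mulrC.
  apply: is_diff_eq (is_diff_scale _ (snorm_is_diff alg A0)) _.
  by apply/funext => h; rewrite mulrC.
split; last 2 first.
- by case: d.
- by move=> w _; rewrite form_of_snormE // omegaR_phiC_field // diff_val.
exists (fun t => phiC t A); split; first exact: phiC0.
- by near=> t; exact: Mphi.
- by have := phiC_is_derive 0 A; rewrite phiC0.
Unshelve. all: by end_near. Qed.

End ConeForm.

(** * The rotation transported to the cotangent bundle *)
Section RotatedCone.
Context {R : rcfType} {V : lmodType R}.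
Context (mul : V -> V -> V) (dot : V -> V -> R) (one : V).
Context (alg : cubic_algebra mul dot one).
Local Notation "x ** y" := (mul x y) (at level 40, left associativity).
Implicit Types (p A : V * V) (x y w : V).

Let mul_lin := (cmulDl alg, cmulZl alg, cmulDr alg, cmulZr alg,
  cmulNl alg, cmulNr alg).
Let dot_lin := (cdotDl alg, cdotZl alg, cdotDr alg, cdotZr alg,
  cdotNl alg, cdotNr alg).

Definition hnorm y : R := Num.sqrt (dot y y / 2).

Definition tau_re p : V := dot p.2 p.2 *: p.1 - p.2 ** p.2.

(** For c = cos(-2t) and s = sin(-2t), the preimage under tau of the image rotated
    by exp(-2 i t), written as a fixed part plus a combination of c and s. *)
Definition flow (c s : R) p : V * V :=
  ((dot p.2 p.2)^-1 *: (p.2 ** p.2), 0)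
  + (c *: ((dot p.2 p.2)^-1 *: tau_re p, p.2)
     + s *: (- (hnorm p.2 / dot p.2 p.2) *: p.2, (hnorm p.2)^-1 *: tau_re p)).

Definition flow_field p : V * V :=
  ((hnorm p.2)^-1 *: p.2, - (2 / hnorm p.2) *: tau_re p).

Lemma hnormE y : hnorm y = cnorm dot y / Num.sqrt 2.
Proof. by rewrite /hnorm sqrtrM ?(cdot_ge0 alg) // sqrtrV. Qed.

Lemma hnorm_sq y : hnorm y ^+ 2 = dot y y / 2.
Proof. by rewrite sqr_sqrtr // mulr_ge0 ?(cdot_ge0 alg). Qed.

Lemma hnorm_gt0 y : y != 0 -> 0 < hnorm y.
Proof. by move=> y0; rewrite sqrtr_gt0 divr_gt0 ?(cdot_gt0 alg). Qed.

Lemma tauE p : tau mul dot p = (tau_re p, hnorm p.2 *: p.2).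
Proof. by rewrite /tau (cnorm_sq alg) hnormE. Qed.

(** ** Rotation of the null cone *)
Section Rotation.
Context (c s : R) (A : V * V).
Context (cs1 : c ^+ 2 + s ^+ 2 = 1) (coneA : in_cone mul A).

Definition rotate : V * V := (c *: A.1 - s *: A.2, c *: A.2 + s *: A.1).

Lemma rotate_sq1 : rotate.1 ** rotate.1 = A.2 ** A.2.
Proof.
case: coneA => uu uv _; rewrite /rotate !mul_lin (cmulC alg A.2 A.1) uv uu.
rewrite !(scaler0, oppr0, addr0, add0r, scalerN, opprK, scalerA).
rewrite -!expr2 -scalerDl cs1.
by rewrite scale1r.
Qed.

(** The square of the imaginary part is invariant; on the side of cotangent
    vectors this says that y ** y is constant along the flow. *)
Lemma rotate_sq2 : rotate.2 ** rotate.2 = A.2 ** A.2.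
Proof.
case: coneA => uu uv _; rewrite /rotate !mul_lin (cmulC alg A.2 A.1) uv uu.
rewrite !(scaler0, addr0, add0r, scalerA) -!expr2 -scalerDl cs1.
by rewrite scale1r.
Qed.

Lemma rotate_mul0 : rotate.1 ** rotate.2 = 0.
Proof.
case: coneA => uu uv _; rewrite /rotate !mul_lin (cmulC alg A.2 A.1) uv uu.
by rewrite !(scaler0, oppr0, addr0, add0r, scalerN, scalerA) mulrC subrr.
Qed.

Lemma rotate_rdot : rdot dot rotate rotate = rdot dot A A.
Proof.
rewrite /rdot /rotate !dot_lin (cdotC alg A.2 A.1).
move: (dot A.1 A.1) (dot A.2 A.2) (dot A.1 A.2) => a b d.
by transitivity ((c ^+ 2 + s ^+ 2) * (a + b)); [ring | rewrite cs1 mul1r].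
Qed.

Lemma rotate_pnorm : pnorm dot rotate = pnorm dot A.
Proof. by rewrite /pnorm rotate_rdot. Qed.

Lemma rotate_in_cone : in_cone mul rotate.
Proof.
split; [by rewrite rotate_sq1 rotate_sq2 | exact: rotate_mul0 |].
case: coneA => _ _ /(rdot_gt0 alg); rewrite -rotate_rdot => r0.
by apply: contraTneq r0 => ->; rewrite /rdot !(cdot0l alg) addr0 ltxx.
Qed.

End Rotation.

(** ** The explicit flow *)
Section FlowOnCotangent.
Context (c s : R) (p : V * V).
Context (cs1 : c ^+ 2 + s ^+ 2 = 1) (Mp : in_cotangent mul dot one p).

Lemma flow_tau_inv : tau_inv mul dot (rotate c s (tau mul dot p)) = flow c s p.
Proof.
have cone := tau_in_cone alg Mp.
rewrite /tau_inv (rotate_pnorm _ cs1) (tau_norm alg Mp).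
have n_gt0 : 0 < dot p.2 p.2 by case: Mp => _ _ _; exact: (cdot_gt0 alg).
have sn0 : Num.sqrt (dot p.2 p.2) != 0 by rewrite gt_eqF ?sqrtr_gt0.
have s20 : Num.sqrt 2 != 0 :> R by rewrite gt_eqF ?sqrtr_gt0.
have k : Num.sqrt 2 / Num.sqrt (dot p.2 p.2) = (hnorm p.2)^-1.
  by rewrite hnormE invfM invrK mulrC.
have r0 : hnorm p.2 != 0 by rewrite hnormE mulf_neq0 ?invr_eq0.
have yy : ((hnorm p.2)^-1 *: (rotate c s (tau mul dot p)).2)
    ** ((hnorm p.2)^-1 *: (rotate c s (tau mul dot p)).2) = p.2 ** p.2.
  rewrite (cmulZl alg) (cmulZr alg) (rotate_sq2 cs1 cone) tauE /=.
  rewrite (cmulZl alg) (cmulZr alg) !scalerA.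
  rewrite [X in X *: _](_ : _ = 1) ?scale1r //.
  by field.
rewrite k; cbv zeta; rewrite yy /rotate tauE /= /flow.
move: n_gt0 r0; move: (hnorm _) (dot _ _) => r n.
move=> n_gt0 r0; congr pair; apply: (cdot_ext alg) => w; rewrite /= !dot_lin.
  by field; rewrite gt_eqF.
by rewrite (cdot0l alg); field.
Qed.

Lemma flow_cotangent : in_cotangent mul dot one (flow c s p).
Proof.
rewrite -flow_tau_inv; apply: (tau_inv_cotangent alg).
exact/rotate_in_cone/(tau_in_cone alg).
Qed.

Lemma tau_flow : tau mul dot (flow c s p) = rotate c s (tau mul dot p).
Proof.
rewrite -flow_tau_inv; apply: (tau_invK alg).
exact/rotate_in_cone/(tau_in_cone alg).
Qed.

Lemma hnorm_flow : hnorm (flow c s p).2 = hnorm p.2.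
Proof.
have cone := tau_in_cone alg Mp.
have rc := rotate_in_cone cs1 cone.
rewrite -flow_tau_inv /hnorm (tau_inv_norm alg rc).
by rewrite (rotate_pnorm _ cs1) (tau_norm alg Mp).
Qed.

Lemma tau_re_flow :
  tau_re (flow c s p) = c *: tau_re p - (s * hnorm p.2) *: p.2.
Proof.
have := congr1 fst tau_flow; rewrite tauE /rotate tauE /= => ->.
by rewrite scalerA.
Qed.

(** The right-hand side is the time derivative of flow: along c = cos(-2t) and
    s = sin(-2t) the derivative of c is 2 s and that of s is -2 c. *)
Lemma flow_field_flow : flow_field (flow c s p) =
  (2 * s) *: ((dot p.2 p.2)^-1 *: tau_re p, p.2)
  + (- 2 * c) *: (- (hnorm p.2 / dot p.2 p.2) *: p.2,
                 (hnorm p.2)^-1 *: tau_re p).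
Proof.
rewrite /flow_field hnorm_flow tau_re_flow.
have r0 : hnorm p.2 != 0.
  by case: Mp => _ _ _ /hnorm_gt0 r0; rewrite gt_eqF.
have n0 : dot p.2 p.2 = 2 * hnorm p.2 ^+ 2 by rewrite hnorm_sq; field.
rewrite /flow /= n0; move: (hnorm _) r0 => r r0.
congr pair; apply: (cdot_ext alg) => w; rewrite /= !dot_lin ?(cdot0l alg);
  by field.
Qed.

(** n x - y^2 is normal to the projective plane at x. *)
Lemma tau_re_orth w : p.1 ** w = 2^-1 *: w -> dot (tau_re p) w = 0.
Proof.
case: Mp => xx trx xy _ xw.
rewrite /tau_re !dot_lin (peirce_dot0 alg xx xw).
by rewrite (peirce_sq_dot alg xx trx xy xw) mulr0 subrr.
Qed.

End FlowOnCotangent.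
End RotatedCone.

(** * Hamilton's equations on the cotangent bundle *)
Section FlowCalculus.
Context {R : realType} (mul : jordan R -> jordan R -> jordan R).
Context (dot : jordan R -> jordan R -> R) (one : jordan R).
Context (alg : cubic_algebra mul dot one).
Local Notation "x ** y" := (mul x y) (at level 40, left associativity).
Implicit Types (p q w : jordan R * jordan R).
Local Notation M := (in_cotangent mul dot one).

Definition time_flow (t : R) p : jordan R * jordan R :=
  flow mul dot (cos (- 2 * t)) (sin (- 2 * t)) p.

Lemma time_flow_is_derive (t : R) p : M p ->
  is_derive t 1 (fun s => time_flow s p)
    (flow_field mul dot (time_flow t p)).
Proof.
move=> Mp; have [dc ds] := is_derive_rotation t.
rewrite (flow_field_flow alg (cos2Dsin2 _) Mp).
exact: is_derive_combination.
Qed.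

Lemma hnorm_is_diff p : p.2 != 0 ->
  is_diff p (fun q => hnorm dot q.2)
    (fun w => dot p.2 w.2 / (2 * hnorm dot p.2)).
Proof.
move=> y0; have r0 := hnorm_gt0 alg y0.
have dl y : linear (dot ^~ y : _ -> R).
  by move=> a u v; rewrite (cdotDl alg) (cdotZl alg).
have dr x : linear (dot x : _ -> R).
  by move=> a u v; rewrite (cdotDr alg) (cdotZr alg).
have d q := @bilinear_is_diff R R dot q dl dr.
have f : is_diff p (fun q : jordan R * jordan R => (q.2, q.2))
    (fun q => (q.2, q.2)) by apply: is_diff_pair; exact: is_diff_snd.
have d2 : is_diff p (fun q => 2^-1 * dot q.2 q.2) (fun w => dot p.2 w.2).
  apply: is_diff_eq (is_diff_scale _ (is_diff_comp f (d _))) _.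
  by apply/funext => w; rewrite /= (cdotC alg w.2); field.
have n0 : 0 < 2^-1 * dot p.2 p.2 by rewrite mulr_gt0 ?invr_gt0 ?(cdot_gt0 alg).
have := @is_diff_sqrt R _ (fun q => 2^-1 * dot q.2 q.2) _ p n0 d2.
rewrite [2^-1 * dot p.2 p.2]mulrC -/(hnorm dot p.2) => d3.
apply: is_diff_near d3; apply: (@filterE _ (nbhs p) (nbhs_filter p)) => q.
by rewrite mulrC.
Qed.

(** Differentiating x o x = x. *)
Lemma curve_tangent_half (g : R -> jordan R * jordan R) w :
  (\forall t \near 0, (g t).1 ** (g t).1 = (g t).1) ->
  is_derive (0 : R) 1 g w -> (g 0).1 ** w.1 = 2^-1 *: w.1.
Proof.
move=> gg /is_derive_diff dg.
have ml y : linear (mul ^~ y).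
  by move=> a u v; rewrite (cmulDl alg) (cmulZl alg).
have mr x : linear (mul x).
  by move=> a u v; rewrite (cmulDr alg) (cmulZr alg).
have d1 := is_diff_comp dg (is_diff_fst (g 0)).
have d2 := is_diff_comp (is_diff_pair d1 d1)
  (@bilinear_is_diff R (jordan R) mul _ ml mr).
have /is_diff_derive - /(_ 1) e2 := d2.
have /is_diff_derive - /(_ 1) e1 := d1.
have gg' : \forall t \near 0, (fst \o g) t
    = ((fun q => q.1 ** q.2) \o (fun t => ((fst \o g) t, (fst \o g) t))) t.
  by apply: filterS gg => t /= ->.
have e3 := near_eq_is_derive gg' e1.
have /= := etrans (esym (@derive_val _ _ _ _ _ _ _ e3))
  (@derive_val _ _ _ _ _ _ _ e2).
rewrite !scale1r (cmulC alg w.1) => wE.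
apply: (cdot_ext alg) => z; have := congr1 (dot ^~ z) wE.
by rewrite (cdotDl alg) (cdotZl alg); lra.
Qed.

Lemma omega_flow_field p w : M p -> p.1 ** w.1 = 2^-1 *: w.1 ->
  2^-1 * (dot (flow_field mul dot p).2 w.1 - dot w.2 (flow_field mul dot p).1)
  = - (dot p.2 w.2 / (2 * hnorm dot p.2)).
Proof.
move=> Mp xw; have r0 : hnorm dot p.2 != 0.
  by case: Mp => _ _ _ /(hnorm_gt0 alg) r0; rewrite gt_eqF.
rewrite /flow_field /= (cdotZl alg) (tau_re_orth alg Mp xw) (cdotZr alg).
by rewrite (cdotC alg w.2); field.
Qed.

End FlowCalculus.

(** * Application to the Cayley projective plane *)
Section Translation.
Context {R : realType}.
Implicit Types (X Y : jordan R) (A : jordanC R) (p q w : jordan R * jordan R).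
Local Open Scope complex_scope.

Local Notation alg := (@jordan_cubic R).

Lemma cotangentP p :
  cayley_cotangent0 p <-> in_cotangent jmul jdot jone p.
Proof.
by rewrite /in_cotangent jdot1; split=> [[[XX trX XY] Y0]|[]].
Qed.

Lemma coneP A : nullcone A <-> in_cone jmul A.
Proof.
have [sq0 sq1] := complex_sq0 alg A.1 A.2.
split=> [[AA A0]|[uu uv A0]].
  have e1 : jmul A.1 A.1 - jmul A.2 A.2 = 0 by exact: (congr1 fst AA).
  have e2 : jmul A.1 A.2 + jmul A.2 A.1 = 0 by exact: (congr1 snd AA).
  by have [] := sq0 (conj e1 e2); split.
have [e1 e2] := sq1 (conj uu uv).
by split; [exact: (f_equal2 pair e1 e2) | exact: A0].
Qed.

Lemma jnormCE A : jnormC A = pnorm jdot A.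
Proof.
rewrite /jnormC /pnorm /rdot; congr (Num.sqrt (_ + _)).
by rewrite /= (cdotNr alg) opprK.
Qed.

Lemma fCE : @fC R = fun A => snorm jdot A / Num.sqrt 2.
Proof. by apply/funext => A; rewrite /fC jnormCE. Qed.

Lemma omegaCE : @omegaC R = form_of_snorm jdot.
Proof.
have E : (fun A => (Num.sqrt (jnormC A))%:C) = fun A => (@snorm R jdot A)%:C.
  by apply/funext => A; rewrite jnormCE.
by rewrite /omegaC E.
Qed.

Lemma normPE Y : normP Y = hnorm jdot Y.
Proof. by []. Qed.

Lemma tauOE p : tauO p = tau jmul jdot p.
Proof. by []. Qed.

Lemma phiC_rotate (t : R) A :
  phiC t A = rotate (cos (- 2 * t)) (sin (- 2 * t)) A.
Proof. by []. Qed.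

Lemma phiC_nullcone (t : R) A : nullcone A -> nullcone (phiC t A).
Proof.
move=> /coneP cA; apply/coneP; rewrite phiC_rotate.
exact: (rotate_in_cone alg (cos2Dsin2 _) cA).
Qed.

Lemma phiC_nullcone_image (t : R) : phiC t @` (@nullcone R) = nullcone.
Proof.
apply/seteqP; split=> [_ [A NA <-]|A NA]; first exact: phiC_nullcone.
exists (phiC (- t) A); first exact: phiC_nullcone.
by rewrite -phiCD subrr phiC0.
Qed.

Lemma tauO_bij : set_bij (@cayley_cotangent0 R) nullcone tauO.
Proof.
split.
- by move=> p /cotangentP Mp; apply/coneP; exact: (tau_in_cone alg Mp).
- move=> p q /set_mem/cotangentP Mp /set_mem/cotangentP Mq.
  exact: (tau_inj alg Mp Mq).
- move=> A /coneP cA; exists (tau_inv jmul jdot A).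
    by apply/cotangentP; exact: (tau_inv_cotangent alg cA).
  exact: (tau_invK alg cA).
Qed.

Lemma fC_tauO p : cayley_cotangent0 p -> fC (tauO p) = normP p.2.
Proof.
move=> /cotangentP Mp; rewrite fCE normPE (hnormE alg) /snorm.
by rewrite tauOE (tau_norm alg Mp).
Qed.

Lemma psiOE (t : R) p : cayley_cotangent0 p ->
  psiO t p = time_flow jmul jdot t p.
Proof.
move=> /cotangentP Mp; have cs := cos2Dsin2 (- 2 * t).
have [_ inj _] := tauO_bij.
have Mq : cayley_cotangent0 (time_flow jmul jdot t p).
  by apply/cotangentP; exact: (flow_cotangent alg cs Mp).
rewrite /psiO tauOE phiC_rotate -(tau_flow alg cs Mp).
exact: (pinvKV _ inj (mem_set Mq)).
Qed.

Lemma psiO_cotangent (t : R) p : cayley_cotangent0 p ->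
  cayley_cotangent0 (psiO t p).
Proof.
move=> Mp; rewrite psiOE //; move/cotangentP: Mp => Mp.
by apply/cotangentP; exact: (flow_cotangent alg (cos2Dsin2 _) Mp).
Qed.

Lemma psiOD (s t : R) p : cayley_cotangent0 p ->
  psiO (s + t) p = psiO s (psiO t p).
Proof.
move=> Mp; have [_ _ surj] := tauO_bij.
rewrite {1}/psiO phiCD; congr (pinv _ _ (phiC s _)); symmetry.
apply: (surjpK _ surj); apply/mem_set/phiC_nullcone.
by have [fun_ _ _] := tauO_bij; exact: fun_.
Qed.

(** The coordinate weights 1 and 2 of the wedge products are those of the inner
    product. *)
Lemma omegaOE p u v :
  omegaO p u v = (2^-1 * (jdot u.2 v.1 - jdot v.2 u.1))%:C.
Proof.
rewrite !jdotE /omegaO; congr (_ * _)%:C.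
rewrite !big_split /= opprD addrACA -sumrB.
congr (_ + _); first by rewrite big_split.
rewrite -!mulr_sumr -mulrBr -sumrB; congr (_ * _).
apply: eq_bigr => i _; rewrite /odot -sumrB.
by apply: eq_bigr => k _; rewrite !mxE.
Qed.

Lemma psiO_hamiltonian :
  hamiltonian_flow (@cayley_cotangent0 R) omegaO (fun p => normP p.2) psiO.
Proof.
have psi0 p : cayley_cotangent0 p -> psiO 0 p = p.
  move=> Mp; rewrite /psiO phiC0; have [_ inj _] := tauO_bij.
  exact: (pinvKV _ inj (mem_set Mp)).
have psi' (t : R) p : cayley_cotangent0 p ->
    is_derive t 1 (fun s => psiO s p) (flow_field jmul jdot (psiO t p)).
  move=> Mp; have -> : (fun s => psiO s p) = fun s => time_flow jmul jdot s p.
    by apply/funext => s; exact: psiOE.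
  rewrite psiOE //; move/cotangentP: Mp => Mp.
  exact: (time_flow_is_derive alg t Mp).
exists (flow_field jmul jdot) => p Mp; last first.
  split=> [|t|s t|t]; [exact: psi0|exact: psiO_cotangent|exact: psiOD|].
  exact: psi'.
have [_ _ _ y0] := (cotangentP p).1 Mp.
have d := hnorm_is_diff alg y0.
split; last 2 first.
- by case: d.
- move=> w [g [g0 gM gw]]; rewrite omegaOE; congr (_%:C).
  have gg : \forall t \near 0, jmul (g t).1 (g t).1 = (g t).1.
    by apply: filterS gM => t /cotangentP [].
  have xw := curve_tangent_half alg gg gw; rewrite g0 in xw.
  rewrite (omega_flow_field alg ((cotangentP p).1 Mp) xw).
  by rewrite [in RHS]diff_val.
exists (fun t => psiO t p); split; first exact: psi0.
- by near=> t; exact: psiO_cotangent.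
- by have := psi' 0 p Mp; rewrite psi0.
Unshelve. all: by end_near. Qed.

(** At unit speed the second component of the flow is the velocity of the first,
    and its own velocity is a multiple of the normal vector n x - y^2. *)
Lemma psiO_geodesic : geodesic_flow (@cayley_sphere R) psiO.
Proof.
move=> p [Tp r1].
have Mp : cayley_cotangent0 p.
  split=> //; apply/eqP => y0; move: r1; rewrite y0 normPE /hnorm.
  by rewrite (cdot0l alg) mul0r sqrtr0 => /esym/eqP; rewrite oner_eq0.
have Mp' := (cotangentP p).1 Mp.
have rt (t : R) : hnorm jdot (time_flow jmul jdot t p).2 = 1.
  by rewrite (hnorm_flow alg (cos2Dsin2 _) Mp').
have Mt (t : R) : in_cotangent jmul jdot jone (time_flow jmul jdot t p).
  exact: (flow_cotangent alg (cos2Dsin2 _) Mp').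
have dt (t : R) := is_derive_diff (time_flow_is_derive alg t Mp').
have d1 (t : R) : is_derive t 1 (fun s => (time_flow jmul jdot s p).1)
    (time_flow jmul jdot t p).2.
  have := is_diff_comp (dt t) (is_diff_fst _).
  move=> /is_diff_derive - /(_ 1) /=.
  by rewrite scale1r /flow_field /= rt invr1 scale1r.
have d2 (t : R) : is_derive t 1 (fun s => (time_flow jmul jdot s p).2)
    (- 2 *: tau_re jmul jdot (time_flow jmul jdot t p)).
  have := is_diff_comp (dt t) (is_diff_snd _).
  move=> /is_diff_derive - /(_ 1) /=.
  by rewrite scale1r /flow_field /= rt divr1.
have g1 : derive1 (fun s => (time_flow jmul jdot s p).1)
    = fun s => (time_flow jmul jdot s p).2.
  by apply/funext => s; rewrite derive1E derive_val.
exists (fun s => (time_flow jmul jdot s p).1).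
  move=> t; rewrite g1; have [XX trX _ _] := Mt t; split.
  - by split => //; rewrite -jdot1.
  - by have [] := d1 t.
  - by have [] := d2 t.
  - move=> w [_ _ Xw]; rewrite derive1E derive_val /metricP (cdotZl alg).
    by rewrite (tau_re_orth alg (Mt t) Xw) mulr0 mul0r.
rewrite g1; split.
  rewrite -surjective_pairing -psiOE // /psiO phiC0; have [_ inj _] := tauO_bij.
  exact: (pinvKV _ inj (mem_set Mp)).
move=> t; have E := psiOE t Mp.
split; last by apply: (etrans E); exact: surjective_pairing.
by rewrite E; have [Tt _] := (cotangentP _).2 (Mt t); split; last exact: rt.
Qed.

End Translation.

Theorem mainTheorem2 (R : realType) :
  symplectic_form (@jordanC0 R) omegaC /\
  hamiltonian_flow (@jordanC0 R) omegaC fC phiC /\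
  (forall t : R, phiC t @` nullcone = nullcone) /\
  hamiltonian_flow (@nullcone R) omegaC fC phiC /\
  set_bij (@cayley_cotangent0 R) nullcone tauO /\
  (forall p : jordan R * jordan R, cayley_cotangent0 p ->
     fC (tauO p) = normP p.2) /\
  hamiltonian_flow (@cayley_cotangent0 R) omegaO (fun p => normP p.2) psiO /\
  geodesic_flow (@cayley_sphere R) psiO.
Proof.
have alg := @jordan_cubic R.
rewrite omegaCE fCE; split; first exact: (form_of_snorm_symplectic alg).
split.
  apply: (phiC_hamiltonian alg) => // t A A0.
  apply: contraTneq (rdot_gt0 alg A0) => phi0.
  by rewrite -(rdot_phiC alg t) phi0 /rdot !(cdot0l alg) addr0 ltxx.
split; first exact: phiC_nullcone_image.
split.
  by apply: (phiC_hamiltonian alg) => [A []|t A]; last exact: phiC_nullcone.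
split; first exact: tauO_bij.
split; first by move=> p /fC_tauO; rewrite fCE.
by split; [exact: psiO_hamiltonian | exact: psiO_geodesic].
Qed.
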